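(* The satisfiability problem of $\mathrm{GRA}(e,p,I,\neg,J,\exists)$ is $\Pi_1^0$-complete.
   Context: AD-relations. $A^0=\{\epsilon\}$, with $\epsilon$ the empty tuple. A $k$-ary AD-relation over a set $A$ is a pair $(R,k)$ with $R\subseteq A^k$, $k\ge 0$; $t\in(R,k)$ means $t\in R$. Vocabularies contain only relation symbols (of any arity $k\ge 0$, countably infinitely many available for each arity). Models have nonempty (possibly infinite) domains; $A$ is the domain of $\mathfrak{A}$. Terms. $\mathrm{GRA}(e,p,I,\neg,J,\exists)$ is the set of terms built from relation symbols and the constant $e$ by the unary operators $p,I,\neg,\exists$ and the binary operator $J$. Each term $\mathcal{T}$ defines in each model $\mathfrak{A}$ an AD-relation $\mathcal{T}^{\mathfrak{A}}$ of arity $\mathit{ar}(\mathcal{T})$. Let $k=\mathit{ar}(\mathcal{T})$, $\ell=\mathit{ar}(\mathcal{S})$. - $R^{\mathfrak{A}}$ is the interpretation of $R$, paired with the arity of $R$; $e^{\mathfrak{A}}=(\{(a,a)\mid a\in A\},2)$. - If $k\ge2$: $(p\mathcal{T})^{\mathfrak{A}}=(\{(a_k,a_1,\dots,a_{k-1})\mid(a_1,\dots,a_k)\in\mathcal{T}^{\mathfrak{A}}\},k)$ and $(I\mathcal{T})^{\mathfrak{A}}=(\{(a_1,\dots,a_{k-1})\mid(a_1,\dots,a_k)\in\mathcal{T}^{\mathfrak{A}},\ a_{k-1}=a_k\},k-1)$; if $k\le1$ both equal $\mathcal{T}^{\mathfrak{A}}$. - $(\neg\mathcal{T})^{\mathfrak{A}}=(\{t\in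 A^k\mid t\notin\mathcal{T}^{\mathfrak{A}}\},k)$. - $(J(\mathcal{T},\mathcal{S}))^{\mathfrak{A}}=(\{(a_1,\dots,a_k,b_1,\dots,b_\ell)\mid(a_1,\dots,a_k)\in\mathcal{T}^{\mathfrak{A}},(b_1,\dots,b_\ell)\in\mathcal{S}^{\mathfrak{A}}\},k+\ell)$. - If $k\ge1$: $(\exists\mathcal{T})^{\mathfrak{A}}=(\{(a_1,\dots,a_{k-1})\mid(a_1,\dots,a_k)\in\mathcal{T}^{\mathfrak{A}}\text{ for some }a_k\in A\},k-1)$; if $k=0$: $(\exists\mathcal{T})^{\mathfrak{A}}=\mathcal{T}^{\mathfrak{A}}$. Satisfiability problem for a set $\mathcal{G}$ of terms: on input $\mathcal{T}\in\mathcal{G}$, answer yes iff there exists a model $\mathfrak{A}$ such that $\mathcal{T}^{\mathfrak{A}}$ is not the empty AD-relation $(\varnothing,\mathit{ar}(\mathcal{T}))$. *)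

(* Defs.v *)
From mathcomp Require Import all_boot.
From mathcomp Require Import boolp classical_sets.
From Stdlib Require Cantor.

Set Implicit Arguments.
Unset Strict Implicit.
Unset Printing Implicit Defensive.

Local Open Scope classical_set_scope.

(* The elements of [k.-tuple A] are those of A^k; [0.-tuple A] has the empty
   tuple as its only element, so there are two AD-relations of arity 0. *)
Record adrel (A : Type) := ADRel {
  ad_arity : nat;
  ad_set : set (ad_arity.-tuple A) }.

Arguments ADRel {A} ad_arity ad_set.
Arguments ad_set {A} a.

Section ADOperations.
Variable A : Type.
Implicit Types X Y : adrel A.

Definition ad_empty (k : nat) : adrel A := ADRel k set0.

Definition ad_eq : adrel A := ADRel 2 [set [tuple a; a] | a in setT].

(* [rotr 1] maps (a_1, ..., a_k) to (a_k, a_1, ..., a_{k-1}). *)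
Definition ad_perm X : adrel A :=
  match X with
  | @ADRel _ k.+2 R => ADRel k.+2 [set [tuple of rotr 1 u] | u in R]
  | _ => X
  end.

(* [tnth t ord_max] is the last entry of the nonempty tuple [t]. *)
Definition ad_ident X : adrel A :=
  match X with
  | @ADRel _ k.+2 R =>
      ADRel k.+1 [set t : k.+1.-tuple A | R [tuple of rcons t (tnth t ord_max)]]
  | _ => X
  end.

Definition ad_neg X : adrel A := ADRel (ad_arity X) (~` ad_set X).

Definition ad_join X Y : adrel A :=
  ADRel (ad_arity X + ad_arity Y)
    [set [tuple of u ++ v] | u in ad_set X & v in ad_set Y].

Definition ad_exists X : adrel A :=
  match X with
  | @ADRel _ k.+1 R =>
      ADRel k [set t : k.-tuple A | exists a : A, R [tuple of rcons t a]]
  | _ => X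
  end.

End ADOperations.

(* Terms of GRA(e, p, I, neg, J, exists). [TRel k i] is the i-th relation symbol
   of arity k. *)
Inductive term :=
| TRel (k i : nat)
| TEq
| TPerm (t : term)
| TIdent (t : term)
| TNeg (t : term)
| TJoin (t s : term)
| TExists (t : term).

(* A model interprets every relation symbol; only those occurring in a term
   affect the value of the term. *)
Record model := Model {
  dom : Type;
  dom_inhabited : inhabited dom;
  interp : forall k : nat, nat -> set (k.-tuple dom) }.

Fixpoint sem (M : model) (t : term) : adrel (dom M) :=
  match t with
  | TRel k i => ADRel k (interp i)
  | TEq => ad_eq (dom M)
  | TPerm t => ad_perm (sem M t)
  | TIdent t => ad_ident (sem M t)
  | TNeg t => ad_neg (sem M t)
  | TJoin t s => ad_join (sem M t) (sem M s)
  | TExists t => ad_exists (sem M t)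
  end.

Definition satisfiable (t : term) : Prop :=
  exists M : model, sem M t <> ad_empty (dom M) (ad_arity (sem M t)).

(* The total recursive functions on tuples of natural numbers. Minimization is
   applied to regular functions only: in [rec_min], [h v] is the least zero of
   [n |-> f (n, v)], which must exist for every [v]. *)
Inductive recursive : forall k : nat, (k.-tuple nat -> nat) -> Prop :=
| rec_zero k : recursive (fun _ : k.-tuple nat => 0)
| rec_succ : recursive (fun v : 1.-tuple nat => (tnth v ord0).+1)
| rec_proj k (i : 'I_k) : recursive (fun v : k.-tuple nat => tnth v i)
| rec_comp k m (f : m.-tuple nat -> nat) (g : 'I_m -> k.-tuple nat -> nat) :
    recursive f -> (forall i, recursive (g i)) ->
    recursive (fun v : k.-tuple nat => f [tuple g i v | i < m])
| rec_prim k (f : k.-tuple nat -> nat) (g : k.+2.-tuple nat -> nat)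
    (h : k.+1.-tuple nat -> nat) :
    recursive f -> recursive g ->
    (forall v : k.-tuple nat, h [tuple of 0 :: v] = f v) ->
    (forall n (v : k.-tuple nat),
       h [tuple of n.+1 :: v] = g [tuple of n :: h [tuple of n :: v] :: v]) ->
    recursive h
| rec_min k (f : k.+1.-tuple nat -> nat) (h : k.-tuple nat -> nat) :
    recursive f ->
    (forall v : k.-tuple nat, f [tuple of h v :: v] = 0) ->
    (forall (v : k.-tuple nat) n, n < h v -> f [tuple of n :: v] <> 0) ->
    recursive h.

(* A relation is recursive when its 0/1-valued characteristic function is. *)
Definition recursive_rel (k : nat) (R : k.-tuple nat -> bool) : Prop :=
  recursive (fun v => nat_of_bool (R v)).

Definition Pi01 (A : set nat) : Prop :=
  exists R : 2.-tuple nat -> bool,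
    recursive_rel R /\ forall x, A x <-> forall y, R [tuple x; y].

Definition many_one_reducible (A B : set nat) : Prop :=
  exists f : 1.-tuple nat -> nat,
    recursive f /\ forall x, A x <-> B (f [tuple x]).

Definition Pi01_complete (A : set nat) : Prop :=
  Pi01 A /\ forall B : set nat, Pi01 B -> many_one_reducible B A.

Definition npair (x y : nat) : nat := Cantor.to_nat (x, y).

Fixpoint code (t : term) : nat :=
  match t with
  | TRel k i => npair 0 (npair k i)
  | TEq => npair 1 0
  | TPerm t => npair 2 (code t)
  | TIdent t => npair 3 (code t)
  | TNeg t => npair 4 (code t)
  | TJoin t s => npair 5 (npair (code t) (code s))
  | TExists t => npair 6 (code t)
  end.

Lemma npair_inj x y x' y' : npair x y = npair x' y' -> x = x' /\ y = y'.
Proof. by move=> /Cantor.to_nat_inj [-> ->]. Qed.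

Lemma code_inj : injective code.
Proof.
elim=> [k i||t IH|t IH|t IH|t IHt s IHs|t IH]
  [k' i'||t'|t'|t'|t' s'|t'] /= /npair_inj [] // _.
- by case/npair_inj => -> ->.
- by move/IH => ->.
- by move/IH => ->.
- by move/IH => ->.
- by case/npair_inj => /IHt -> /IHs ->.
- by move/IH => ->.
Qed.

(* The satisfiability problem as the set of codes of its yes-instances. *)
Definition GRA_SAT : set nat := [set code t | t in satisfiable].

(* Main.v *)
From mathcomp Require Import all_boot.
From mathcomp Require Import boolp classical_sets.
From Stdlib Require List Cantor.
Require Import Defs.

(* Membership. A term is satisfiable iff a countable Henkin-style assignment of
   truth values to the atoms "the tuple of constants u belongs to T" exists, T
   ranging over all terms. With Skolem constants as witnesses for the
   projections, the conditions on such an assignment are the instances of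
   finitely many propositional clause schemas in the codes of T and u, with
   auxiliary atoms for arities, concatenation and well-formedness, so that no
   recursion over terms has to be computed. By compactness the existence of the
   assignment is a Pi01 condition. Equality only has to be a congruence in the
   position that projections act on, because the model consists of one
   representative of each class of constants.

   Hardness. Although permutations of tuples are limited to rotations, the terms
   of arity 2 express Tarski's calculus of relations (converse, composition,
   intersection, complement). Over binary trees every recursive function is the
   denotation of an expression built from the projections, leaf test, converse,
   composition, intersection and reflexive transitive closure. Such an expression
   is monotone, so it denotes the empty relation over trees iff its emptiness is
   consistent with the pairing axioms and the closure axioms for its stars. *)

Set Implicit Arguments.
Unset Strict Implicit.
Unset Printing Implicit Defensive.

(** * Semantics on lists *)

Fixpoint arity (t : term) : nat :=
  match t with
  | TRel k _ => k
  | TEq => 2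
  | TPerm t | TNeg t => arity t
  | TIdent t => if arity t is k.+2 then k.+1 else arity t
  | TJoin t s => arity t + arity s
  | TExists t => (arity t).-1
  end.

(* Tuples are stored in reverse order as lists, so that identification and
   projection act on the head of the list. *)
Fixpoint rsem (A : Type) (I : nat -> nat -> seq A -> Prop) (t : term)
    (s : seq A) : Prop :=
  match t with
  | TRel k i => size s = k /\ I k i s
  | TEq => exists a, s = [:: a; a]
  | TPerm t => rsem I t (rotr 1 s)
  | TIdent t =>
      if arity t <= 1 then rsem I t s
      else if s is a :: s' then rsem I t [:: a, a & s'] else False
  | TNeg t => size s = arity t /\ ~ rsem I t s
  | TJoin t1 t2 => exists u v, [/\ s = v ++ u, rsem I t1 u & rsem I t2 v]
  | TExists t =>
      if arity t == 0 then rsem I t s else exists a, rsem I t (a :: s)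
  end.

Lemma rsem_size A I t (s : seq A) : rsem I t s -> size s = arity t.
Proof.
elim: t s => [k i||t IH|t IH|t IH|t IHt t' IHt'|t IH] s /=.
- by case.
- by case=> a ->.
- by move/IH; rewrite size_rotr.
- case: ifP => [le1 /IH ->|]; first by case: (arity t) le1 => [|[]].
  by case: s => // a s le1 /IH /= <-.
- by case.
- by case=> [u [v [-> /IHt <- /IHt' <-]]]; rewrite size_cat addnC.
- by case: eqP => [e /IH ->|_ [a /IH /= <-]] //; rewrite e.
Qed.

Section ReversedMembership.
Variable A : Type.
Implicit Types X Y : adrel A.

(** Membership on plain reversed lists is free of the arity index of [adrel], so each operation
    becomes an equivalence between statements on lists. *)
Definition rmem X (s : seq A) : Prop :=
  exists2 u : (ad_arity X).-tuple A, ad_set X u & rev u = s.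

Lemma rmem_size X s : rmem X s -> size s = ad_arity X.
Proof. by case=> u _ <-; rewrite size_rev size_tuple. Qed.

Lemma rmem_tuple X (u : (ad_arity X).-tuple A) : rmem X (rev u) <-> ad_set X u.
Proof.
split=> [[v Xv /(can_inj revK) eq_vu]|Xu]; last by exists u.
by have <- : v = u by apply: val_inj.
Qed.

Lemma rotr1_small (s : seq A) : size s <= 1 -> rotr 1 s = s.
Proof. by case: s => [|a []]. Qed.

Lemma rmem_perm X s : rmem (ad_perm X) s <-> rmem X (rotr 1 s).
Proof.
case: X => [[|[|k]] R].
1,2: by split=> H; have := rmem_size H; rewrite ?size_rotr => /= size_s;
  move: H; rewrite rotr1_small ?size_s.
(* Reversal turns the right rotation of a tuple into a left rotation, which [rotr 1] undoes. *)
split=> [[_ [u Ru <-] <-]|[u Ru eq_s]] /=.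
  by exists u; rewrite // rev_rotr rotK.
exists [tuple of rotr 1 u]; first by exists u.
by rewrite /= rev_rotr eq_s rotrK.
Qed.

Lemma rmem_ident X s :
  rmem (ad_ident X) s <->
  if ad_arity X <= 1 then rmem X s
  else if s is a :: s' then rmem X [:: a, a & s'] else False.
Proof.
case: X => [[|[|k]] R] //=.
have last_tuple (w : k.+1.-tuple A) a s' :
    rev w = a :: s' -> tnth w ord_max = a.
  move=> eq_w; rewrite (tnth_nth a) /= -[tval w]revK eq_w rev_cons nth_rcons.
  have: size (rev w) = k.+1 by rewrite size_rev size_tuple.
  by rewrite eq_w /= size_rev => -[->]; rewrite ltnn eqxx.
case: s => [|a s'].
  by split=> // /rmem_size.
split.
  case=> w /= Rw eq_w; exists [tuple of rcons w (tnth w ord_max)] => //=.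
  by rewrite rev_rcons eq_w (last_tuple _ _ _ eq_w).
case=> u /= Ru eq_u.
have hw : size (rev (a :: s')) == k.+1.
  by have /eqP := size_tuple u; rewrite -size_rev eq_u /= size_rev eqSS.
have eq_w : rev (Tuple hw) = a :: s' by rewrite /= revK.
exists (Tuple hw) => //=; rewrite (last_tuple _ _ _ eq_w).
suff -> : [tuple of rcons (Tuple hw) a] = u by [].
by apply: val_inj; rewrite /= -rev_cons -eq_u revK.
Qed.

Lemma rmem_neg X s :
  rmem (ad_neg X) s <-> size s = ad_arity X /\ ~ rmem X s.
Proof.
split=> [[u nXu <-]|[size_s nXs]].
  by rewrite size_rev size_tuple rmem_tuple.
have h : size (rev s) == ad_arity X by rewrite size_rev size_s.
exists (Tuple h); last by rewrite /= revK.
by move=> /= Xs; apply: nXs; exists (Tuple h); rewrite //= revK.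
Qed.

Lemma rmem_join X Y s :
  rmem (ad_join X Y) s <-> exists u v, [/\ s = v ++ u, rmem X u & rmem Y v].
Proof.
split=> [[_ [u Xu [v Yv <-]] <-]|[_ [_ [-> [u Xu <-] [v Yv <-]]]]].
  by exists (rev u), (rev v); split; [rewrite -rev_cat|apply/rmem_tuple..].
by exists [tuple of u ++ v]; [exists u => //; exists v|rewrite /= rev_cat].
Qed.

Lemma rmem_exists X s :
  rmem (ad_exists X) s <->
  if ad_arity X == 0 then rmem X s else exists a, rmem X (a :: s).
Proof.
case: X => [[|k] R] //=; split=> [[w [a /= Ra] <-]|[a [u /= Ru eq_u]]].
  by exists a, [tuple of rcons w a]; rewrite //= rev_rcons.
have hw : size (rev s) == k.
  by have /eqP := size_tuple u; rewrite -size_rev eq_u /= size_rev eqSS.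
exists (Tuple hw); last by rewrite /= revK.
exists a; suff -> : [tuple of rcons (Tuple hw) a] = u by [].
by apply: val_inj; rewrite /= -rev_cons -eq_u revK.
Qed.

End ReversedMembership.

Definition rinterp (M : model) (k i : nat) : seq (dom M) -> Prop :=
  rmem (ADRel k (@interp M k i)).

Lemma sem_arity M t : ad_arity (sem M t) = arity t.
Proof.
elim: t => [k i||t IH|t IH|t IH|t IHt s IHs|t IH] //=.
- by rewrite -IH; case: (sem M t) => [[|[|k]] R].
- by rewrite -IH; case: (sem M t) => [[|[|k]] R].
- by rewrite IHt IHs.
- by rewrite -IH; case: (sem M t) => [[|k] R].
Qed.

Lemma rmem_sem M t s : rmem (sem M t) s <-> rsem (@rinterp M) t s.
Proof.
elim: t s => [k i||t IH|t IH|t IH|t IHt t' IHt'|t IH] s /=.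
- by split=> [H|[]//]; split=> //; have := rmem_size H.
- split=> [[_ [a _ <-] <-]|[a ->]]; first by exists a.
  by exists [tuple a; a] => //; exists a.
- by rewrite rmem_perm IH.
- rewrite rmem_ident sem_arity; case: ifP => _ //.
  by case: s.
- by rewrite rmem_neg sem_arity IH.
- rewrite rmem_join; split=> -[u [v [-> Hu Hv]]]; exists u, v; split=> //.
  + exact/IHt.
  + exact/IHt'.
  + exact/IHt.
  + exact/IHt'.
- rewrite rmem_exists sem_arity; case: ifP => _ //.
  by split=> -[a /IH]; exists a.
Qed.

Lemma satisfiableE t :
  satisfiable t <->
  exists2 A : Type, inhabited A &
    exists (I : nat -> nat -> seq A -> Prop) (s : seq A), rsem I t s.
Proof.
split=> [[M ne]|[A A0 [I [s ts]]]].
  exists (dom M); first exact: dom_inhabited.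
  exists (@rinterp M).
  case: (pselect (exists u, ad_set (sem M t) u)) => [[u tu]|no].
    by exists (rev u); apply/rmem_sem/rmem_tuple.
  case: ne; case: (sem M t) no => k R /= no.
  rewrite /ad_empty; congr ADRel; apply/seteqP; split=> // u Ru.
  by case: no; exists u.
(* [I] acts on reversed lists, hence the reversal in the interpretation. *)
pose M := Model A0 (fun k i => [set u : k.-tuple A | I k i (rev u)]%classic).
exists M => eq0.
have rsemE : forall t' s', rsem (@rinterp M) t' s' <-> rsem I t' s'.
  elim=> [k i||t' IH|t' IH|t' IH|t1 IH1 t2 IH2|t' IH] s' //=.
  - split=> -[size_s' H]; split=> //.
      by case: H => u Iu <-.
    have h : size (rev s') == k by rewrite size_rev size_s'.
    by exists (Tuple h); rewrite /= revK.
  - by case: ifP => _ //; case: s'.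
  - by rewrite IH.
  - split=> -[u [v [-> /IH1 Hu /IH2 Hv]]]; exists u, v; split=> //.
  - by case: ifP => _ //; split=> -[a /IH]; exists a.
have /rmem_sem : rsem (@rinterp M) t s by apply/rsemE.
by rewrite eq0 => -[].
Qed.

(** * Recursive functions *)

Section RecursiveFunctions.
Implicit Types k : nat.

Lemma rec_ext k (f g : k.-tuple nat -> nat) : f =1 g -> recursive f -> recursive g.
Proof. by move=> /funext ->. Qed.

Lemma rec_app1 k (f : 1.-tuple nat -> nat) (g : k.-tuple nat -> nat) :
  recursive f -> recursive g -> recursive (fun v => f [tuple g v]).
Proof.
move=> Rf Rg; apply: rec_ext (rec_comp Rf (fun=> Rg)) => v.
by congr f; apply: eq_from_tnth => i; rewrite tnth_mktuple ord1.
Qed.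

Lemma rec_succ' k (f : k.-tuple nat -> nat) :
  recursive f -> recursive (fun v => (f v).+1).
Proof. by move=> Rf; apply: rec_ext (rec_app1 rec_succ Rf). Qed.

Lemma rec_const k n : recursive (fun _ : k.-tuple nat => n).
Proof. by elim: n => [|n IH]; [exact: rec_zero|exact: rec_succ']. Qed.

Lemma rec_head k : recursive (fun w : k.+1.-tuple nat => thead w).
Proof. exact: rec_proj. Qed.

Lemma rec_lift k (f : k.-tuple nat -> nat) :
  recursive f -> recursive (fun w : k.+1.-tuple nat => f [tuple of behead w]).
Proof.
move=> Rf.
apply: rec_ext (rec_comp Rf (fun i => rec_proj (lift ord0 i))) => w.
congr f; apply: eq_from_tnth => i; rewrite tnth_mktuple.
by rewrite !(tnth_nth 0) /= nth_behead.
Qed.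

(** Primitive recursion with parameters: the step sees the counter, the accumulator and [v]. The
    scheme [rec_prim] yields a function of counter and parameters, and composition with [n] and the
    projections supplies the number of steps. *)
Lemma rec_nat_rect k (n a : k.-tuple nat -> nat)
    (g : nat -> nat -> k.-tuple nat -> nat) :
  recursive n -> recursive a ->
  recursive (fun w : k.+2.-tuple nat =>
    g (thead w) (thead [tuple of behead w]) [tuple of behead (behead w)]) ->
  recursive (fun v => nat_rect _ (a v) (fun i acc => g i acc v) (n v)).
Proof.
move=> Rn Ra Rg.
pose h (w : k.+1.-tuple nat) := nat_rect (fun=> nat) (a [tuple of behead w])
  (fun i acc => g i acc [tuple of behead w]) (thead w).
have beheadK j x (v : j.-tuple nat) : [tuple of behead [tuple of x :: v]] = v.
  exact: val_inj.
have Rh : recursive h.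
  apply: rec_prim Ra Rg _ _ => [v|m v]; first by rewrite /h beheadK theadE.
  rewrite /h !beheadK !theadE /=; congr g.
  exact: val_inj.
have R (i : 'I_k.+1) :
    recursive (if unlift ord0 i is Some j then fun v => tnth v j else n).
  by case: unliftP => [j|] _ //; apply: rec_proj.
apply: rec_ext (rec_comp Rh R) => v.
have -> : [tuple (if unlift ord0 i is Some j then fun v => tnth v j else n) v
          | i < k.+1] = [tuple of n v :: v].
  apply: eq_from_tnth => i; rewrite tnth_mktuple.
  case: unliftP => [j ->|->]; last by rewrite (tnth_nth 0).
  by rewrite !(tnth_nth 0).
by rewrite /h beheadK theadE.
Qed.

Lemma rec_add k (f g : k.-tuple nat -> nat) :
  recursive f -> recursive g -> recursive (fun v => f v + g v).
Proof.
move=> Rf Rg; pose s (i acc : nat) (v : k.-tuple nat) := acc.+1.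
apply: rec_ext (@rec_nat_rect k g f s Rg Rf _) => [v|].
  by elim: (g v) => [|n IH] /=; rewrite ?addn0 // /s IH addnS.
exact/rec_succ'/rec_lift/rec_head.
Qed.

Lemma rec_sum k (n : k.-tuple nat -> nat) (f : nat -> k.-tuple nat -> nat) :
  recursive n ->
  recursive (fun w : k.+1.-tuple nat => f (thead w) [tuple of behead w]) ->
  recursive (fun v => \sum_(i < n v) f i v).
Proof.
move=> Rn Rf; pose s i acc v := acc + f i v.
apply: rec_ext (@rec_nat_rect k n _ s Rn (rec_zero k) _) => [v|].
  by elim: (n v) => [|m IH] /=; rewrite ?big_ord0 // big_ord_recr /s IH.
apply: rec_add; first exact/rec_lift/rec_head.
(* The step receives counter, accumulator and parameters; [pr] skips position 1, the accumulator. *)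
pose pr (i : 'I_k.+1) : 'I_k.+2 :=
  if unlift ord0 i is Some j then lift ord0 (lift ord0 j) else ord0.
apply: rec_ext (rec_comp Rf (fun i => rec_proj (pr i))) => w.
congr f; first by rewrite /thead tnth_mktuple /pr unlift_none.
apply: eq_from_tnth => i; rewrite !(tnth_nth 0) /= !nth_behead.
rewrite -[i.+1]/(nat_of_ord (lift ord0 i)) nth_mktuple /pr liftK.
by rewrite (tnth_nth 0).
Qed.

Lemma rec_mul k (f g : k.-tuple nat -> nat) :
  recursive f -> recursive g -> recursive (fun v => f v * g v).
Proof.
move=> Rf Rg; apply: rec_ext (@rec_sum k f (fun=> g) Rf (rec_lift Rg)) => v.
by rewrite sum_nat_const card_ord.
Qed.

Lemma rec_pred k (f : k.-tuple nat -> nat) :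
  recursive f -> recursive (fun v => (f v).-1).
Proof.
move=> Rf; pose s (i acc : nat) (v : k.-tuple nat) := i.
apply: rec_ext (@rec_nat_rect k f _ s Rf (rec_zero k) (rec_head _)) => v.
by case: (f v).
Qed.

Lemma rec_sub k (f g : k.-tuple nat -> nat) :
  recursive f -> recursive g -> recursive (fun v => f v - g v).
Proof.
move=> Rf Rg; pose s (i acc : nat) (v : k.-tuple nat) := acc.-1.
apply: rec_ext (@rec_nat_rect k g f s Rg Rf _) => [v|].
  by elim: (g v) => [|n IH] /=; rewrite ?subn0 // /s IH subnS.
exact/rec_pred/rec_lift/rec_head.
Qed.

Lemma rec_exp2 k (f : k.-tuple nat -> nat) :
  recursive f -> recursive (fun v => 2 ^ f v).
Proof.
move=> Rf; pose s (i acc : nat) (v : k.-tuple nat) := acc + acc.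
apply: rec_ext (@rec_nat_rect k f _ s Rf (rec_const k 1) _) => [v|].
  by elim: (f v) => [|n IH] //=; rewrite /s IH addnn expnS mul2n.
by apply: rec_add; exact/rec_lift/rec_head.
Qed.

Lemma rec_neg k (b : k.-tuple nat -> bool) :
  recursive (fun v => b v : nat) -> recursive (fun v => ~~ b v : nat).
Proof.
move=> Rb; apply: rec_ext (rec_sub (rec_const k 1) Rb) => v.
by case: (b v).
Qed.

Lemma rec_leq k (f g : k.-tuple nat -> nat) :
  recursive f -> recursive g -> recursive (fun v => f v <= g v : nat).
Proof.
move=> Rf Rg.
apply: rec_ext (rec_sub (rec_const k 1) (rec_sub Rf Rg)) => v.
by rewrite -subn_eq0; case: (f v - g v).
Qed.

Lemma rec_and k (b c : k.-tuple nat -> bool) :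
  recursive (fun v => b v : nat) -> recursive (fun v => c v : nat) ->
  recursive (fun v => b v && c v : nat).
Proof. by move=> Rb Rc; apply: rec_ext (rec_mul Rb Rc) => v; rewrite mulnb. Qed.

Lemma rec_eq k (f g : k.-tuple nat -> nat) :
  recursive f -> recursive g -> recursive (fun v => f v == g v : nat).
Proof.
move=> Rf Rg; apply: rec_ext (rec_and (rec_leq Rf Rg) (rec_leq Rg Rf)) => v.
by rewrite eqn_leq.
Qed.

Lemma rec_or k (b c : k.-tuple nat -> bool) :
  recursive (fun v => b v : nat) -> recursive (fun v => c v : nat) ->
  recursive (fun v => b v || c v : nat).
Proof.
move=> Rb Rc; apply: rec_ext (rec_neg (rec_and (rec_neg Rb) (rec_neg Rc))) => v.
by rewrite negb_and !negbK.
Qed.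

Lemma rec_implb k (b c : k.-tuple nat -> bool) :
  recursive (fun v => b v : nat) -> recursive (fun v => c v : nat) ->
  recursive (fun v => b v ==> c v : nat).
Proof.
by move=> Rb Rc; apply: rec_ext (rec_or (rec_neg Rb) Rc) => v; rewrite implybE.
Qed.

Lemma rec_all T k (s : seq T) (b : T -> k.-tuple nat -> bool) :
  (forall x, recursive (fun v => b x v : nat)) ->
  recursive (fun v => all (b^~ v) s : nat).
Proof.
move=> Rb; elim: s => [|x s IH] /=; first exact: (rec_const k 1).
exact: rec_and.
Qed.

Lemma rec_has T k (s : seq T) (b : T -> k.-tuple nat -> bool) :
  (forall x, recursive (fun v => b x v : nat)) ->
  recursive (fun v => has (b^~ v) s : nat).
Proof.
move=> Rb; elim: s => [|x s IH] /=; first exact: rec_zero.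
exact: rec_or.
Qed.

Lemma rec_exists_lt k (n : k.-tuple nat -> nat) (b : nat -> k.-tuple nat -> bool) :
  recursive n ->
  recursive (fun w : k.+1.-tuple nat => b (thead w) [tuple of behead w] : nat) ->
  recursive (fun v => [exists i : 'I_(n v), b i v] : nat).
Proof.
move=> Rn Rb.
apply: rec_ext (rec_leq (rec_const k 1) (rec_sum (f := fun i v => b i v) Rn Rb)).
move=> v; congr nat_of_bool; apply/idP/existsP => [|[i bi]].
  rewrite lt0n sum_nat_eq0 negb_forall => /existsP [i].
  by rewrite implyTb eqb0 negbK => bi; exists i.
by rewrite (bigD1 i) //= bi.
Qed.

Lemma rec_forall_lt k (n : k.-tuple nat -> nat) (b : nat -> k.-tuple nat -> bool) :
  recursive n ->
  recursive (fun w : k.+1.-tuple nat => b (thead w) [tuple of behead w] : nat) ->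
  recursive (fun v => [forall i : 'I_(n v), b i v] : nat).
Proof.
move=> Rn Rb.
apply: rec_ext (rec_neg (rec_exists_lt (b := fun i v => ~~ b i v) Rn (rec_neg Rb))).
by move=> v; rewrite negb_exists; under eq_forallb do rewrite negbK.
Qed.

Lemma rec_half k (f : k.-tuple nat -> nat) :
  recursive f -> recursive (fun v => (f v)./2).
Proof.
(* The recursion h(0) = 0, h(i+1) = i - h(i) computes halves, since i minus its rounded-down half is
   its rounded-up half. *)
move=> Rf; pose s (i acc : nat) (v : k.-tuple nat) := i - acc.
apply: rec_ext (@rec_nat_rect k f _ s Rf (rec_zero k) _) => [v|].
  elim: (f v) => [|n IH] //; rewrite [LHS]/= /s IH -{1}(odd_double_half n).
  by rewrite -addnn addnA addnK /= uphalf_half.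
exact: rec_sub (rec_head _) (rec_lift (rec_head _)).
Qed.

Lemma rec_odd k (f : k.-tuple nat -> nat) :
  recursive f -> recursive (fun v => odd (f v) : nat).
Proof.
move=> Rf; pose h v := (f v)./2.
have Rh : recursive h by apply: rec_half.
apply: rec_ext (rec_sub Rf (rec_add Rh Rh)) => v.
by rewrite /h addnn -{1}(odd_double_half (f v)) addnK.
Qed.

(** Binary digits: a number below 2^N serves as a truth assignment to the atoms below N. *)
Definition bit (b i : nat) : bool := odd (iter i half b).

Lemma rec_bit k (f g : k.-tuple nat -> nat) :
  recursive f -> recursive g -> recursive (fun v => bit (f v) (g v) : nat).
Proof.
move=> Rf Rg; apply: rec_odd; pose s (i acc : nat) (v : k.-tuple nat) := acc./2.
apply: rec_ext (@rec_nat_rect k g f s Rg Rf _) => [v|].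
  by elim: (g v) => [|n IH] //=; rewrite /s IH.
exact/rec_half/rec_lift/rec_head.
Qed.

Lemma bit_surj N (sigma : nat -> bool) :
  exists2 b, b < 2 ^ N & forall i, i < N -> bit b i = sigma i.
Proof.
elim: N sigma => [|N IH] sigma; first by exists 0.
have [b ltb bitb] := IH (sigma \o succn).
exists (sigma 0 + b.*2).
  rewrite expnS mul2n; case: (sigma 0); rewrite ?add0n ?ltn_double //.
  by rewrite ltn_Sdouble.
case=> [|i] lti; first by rewrite /bit /= oddD odd_double addbF oddb.
by rewrite /bit iterSr half_bit_double; apply: bitb.
Qed.

Lemma npairE x y : npair x y = y + \sum_(i < (y + x).+1) i.
Proof.
rewrite /npair /Cantor.to_nat -[Nat.add]/addn; congr addn.
elim: (y + x) => [|n IH]; first by rewrite big_ord_recr big_ord0.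
by rewrite big_ord_recr /= -IH addnC.
Qed.

Lemma rec_npair k (f g : k.-tuple nat -> nat) :
  recursive f -> recursive g -> recursive (fun v => npair (f v) (g v)).
Proof.
move=> Rf Rg; pose n v := (g v + f v).+1.
have Rn : recursive n by apply/rec_succ'/rec_add.
apply: rec_ext (rec_add Rg (rec_sum (f := fun i _ => i) Rn (rec_head _))) => v.
by rewrite npairE.
Qed.

Lemma leq_npair x y : x + y <= npair x y.
Proof.
by rewrite npairE big_ord_recr /= addnA [x + y]addnC leq_addl.
Qed.

Definition unpair1 n := (Cantor.of_nat n).1.
Definition unpair2 n := (Cantor.of_nat n).2.

Lemma npairK n : npair (unpair1 n) (unpair2 n) = n.
Proof.
rewrite /npair /unpair1 /unpair2 -[RHS]Cantor.cancel_to_of.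
by case: (Cantor.of_nat n).
Qed.

Lemma unpair1E x y : unpair1 (npair x y) = x.
Proof. by rewrite /unpair1 Cantor.cancel_of_to. Qed.

Lemma unpair2E x y : unpair2 (npair x y) = y.
Proof. by rewrite /unpair2 Cantor.cancel_of_to. Qed.

(** Both components are at most the code and pairing is injective, so the double sum has a single
    surviving term. Decoding thereby reduces to bounded sums. *)
Lemma unpair_sum (F : nat -> nat -> nat) n :
  \sum_(x < n.+1) \sum_(y < n.+1) F x y * (npair x y == n) =
  F (unpair1 n) (unpair2 n).
Proof.
have le1 : unpair1 n < n.+1.
  by rewrite ltnS -{2}(npairK n) (leq_trans _ (leq_npair _ _)) ?leq_addr.
have le2 : unpair2 n < n.+1.
  by rewrite ltnS -{2}(npairK n) (leq_trans _ (leq_npair _ _)) ?leq_addl.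
rewrite (bigD1 (Ordinal le1)) //= (bigD1 (Ordinal le2)) //= npairK eqxx muln1.
rewrite !big1 ?addn0 // => [x nx|y ny].
  rewrite big1 // => y _; case: eqP => [en|]; last by rewrite muln0.
  by case/eqP: nx; apply: val_inj; have := unpair1E x y; rewrite en.
case: eqP => [en|]; last by rewrite muln0.
by case/eqP: ny; apply: val_inj; have := unpair2E (unpair1 n) y; rewrite en.
Qed.

Lemma rec_unpair_sum k (F : nat -> nat -> nat) (f : k.-tuple nat -> nat) :
  (forall j (g h : j.-tuple nat -> nat), recursive g -> recursive h ->
     recursive (fun v => F (g v) (h v))) ->
  recursive f -> recursive (fun v => F (unpair1 (f v)) (unpair2 (f v))).
Proof.
move=> RF Rf; pose G (x : nat) v := \sum_(y < (f v).+1) F x y * (npair x y == f v).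
apply: rec_ext (@rec_sum k (fun v => (f v).+1) G (rec_succ' Rf) _) => [v|].
  by rewrite unpair_sum.
pose f' (w : k.+1.-tuple nat) := f [tuple of behead w].
have Rf' : recursive f' by apply: rec_lift.
pose H (y : nat) (w : k.+1.-tuple nat) :=
  F (thead w) y * (npair (thead w) y == f' w).
apply: (@rec_sum k.+1 (fun w => (f' w).+1) H (rec_succ' Rf')).
have R1 := rec_lift (rec_head k).
apply: rec_mul; first by apply: RF => //; apply: rec_head.
by apply: rec_eq; [apply: rec_npair => //; apply: rec_head|apply: rec_lift].
Qed.

Lemma rec_unpair1 k (f : k.-tuple nat -> nat) :
  recursive f -> recursive (fun v => unpair1 (f v)).
Proof. exact: (@rec_unpair_sum k (fun x _ => x)). Qed.

Lemma rec_unpair2 k (f : k.-tuple nat -> nat) :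
  recursive f -> recursive (fun v => unpair2 (f v)).
Proof. exact: (@rec_unpair_sum k (fun _ y => y)). Qed.

End RecursiveFunctions.

(** * Compactness for propositional clauses *)

Section Konig.
Variable P : nat -> (nat -> bool) -> Prop.
Hypothesis P_anti : forall N sigma, P N.+1 sigma -> P N sigma.
Hypothesis P_local : forall N sigma tau,
  (forall i, i < N -> sigma i = tau i) -> P N sigma -> P N tau.
Hypothesis P_sat : forall N, exists sigma, P N sigma.

Let P_le M N sigma : M <= N -> P N sigma -> P M sigma.
Proof.
move=> /subnK <-; elim: (N - M) => [|d IH] //= PN.
exact/IH/P_anti.
Qed.

(** The nodes of the binary tree above which witnesses of [P N] exist for every N. *)
Let good (s : seq bool) : Prop := forall N, exists2 sigma,
  P N sigma & forall i, i < size s -> sigma i = nth false s i.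

Let next (s : seq bool) : seq bool := rcons s `[< good (rcons s true) >].

(** If appending [true] fails at some level M, then a witness for level max(M, N) extending [s] must
    take the value [false] at the new position, so appending [false] is good. *)
Let good_next s : good s -> good (next s).
Proof.
move=> gs; rewrite /next; case: asboolP => // /existsNP [M noM] N.
have [sigma Psigma ext] := gs (maxn M N).
have PM := P_le (leq_maxl M N) Psigma; have PN := P_le (leq_maxr M N) Psigma.
have ext' c : sigma (size s) = c ->
    forall i, i < size (rcons s c) -> sigma i = nth false (rcons s c) i.
  move=> sc i; rewrite size_rcons ltnS leq_eqVlt nth_rcons => /orP [/eqP ->|lti].
    by rewrite ltnn eqxx.
  by rewrite lti ext.
case E: (sigma (size s)); last by exists sigma => //; apply: ext'.
by case: noM; exists sigma => //; apply: ext'.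
Qed.

(** The limit of the prefixes agrees below N with a witness of [P N], and [P N] depends only on
    those values. *)
Lemma konig : exists sigma, forall N, P N sigma.
Proof.
pose pre n := iter n next [::].
have size_pre n : size (pre n) = n by elim: n => //= n IH; rewrite size_rcons IH.
have good_pre n : good (pre n).
  by elim: n => [|n IH] /=; [move=> N; have [sigma] := P_sat N; exists sigma
                            |exact: good_next].
exists (fun i => nth false (pre i.+1) i) => N.
have [sigma PN ext] := good_pre N N; apply: P_local PN => i ltiN.
rewrite ext ?size_pre // -(subnK ltiN); elim: (N - i.+1) => //= d IH.
by rewrite nth_rcons size_pre addnS ltnS leq_addl -addnS.
Qed.

End Konig.

(** * Clause schemas over coded atoms, and the Pi01 form of their satisfiability *)

Inductive exp :=
| EVar (i : nat)
| ENat (n : nat)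
| ESucc (e : exp)
| EPair (e1 e2 : exp).

Fixpoint eval (env : nat -> nat) (e : exp) : nat :=
  match e with
  | EVar i => env i
  | ENat n => n
  | ESucc e => (eval env e).+1
  | EPair e1 e2 => npair (eval env e1) (eval env e2)
  end.

(* The pair [(ps, qs)] stands for the clause "if all atoms in [ps] are true then
   some atom in [qs] is true"; atoms are natural numbers, given by expressions in
   universally quantified variables. *)
Definition clause : Type := (seq exp * seq exp)%type.

Definition clause_true (sigma : nat -> bool) (env : nat -> nat) (C : clause) :=
  all (fun e => sigma (eval env e)) C.1 ==> has (fun e => sigma (eval env e)) C.2.

Definition clauses_true (G : seq clause) (sigma : nat -> bool) : Prop :=
  forall env C, List.In C G -> clause_true sigma env C.

Section ClausesPi01.

(** One number codes an environment by iterated pairing; on the finitely many variables of a clause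
    every environment is reached. *)
Definition project (n i : nat) : nat := unpair1 (iter i unpair2 n).

Lemma project_surj (env : nat -> nat) m :
  exists n, forall i, i < m -> project n i = env i.
Proof.
elim: m env => [|m IH] env; first by exists 0.
have [n nP] := IH (env \o succn); exists (npair (env 0) n).
by case=> [|i] lti; rewrite /project ?iterSr ?unpair1E ?unpair2E //; apply: nP.
Qed.

Lemma rec_eval k (n : k.-tuple nat -> nat) e :
  recursive n -> recursive (fun v => eval (project (n v)) e).
Proof.
move=> Rn; elim: e => [i|c|e IH|e1 IH1 e2 IH2] /=.
- apply: rec_unpair1; elim: i => [|i IH] //=; exact: rec_unpair2.
- exact: rec_const.
- exact: rec_succ'.
- exact: rec_npair.
Qed.

Fixpoint var_bound (e : exp) : nat :=
  match e with
  | EVar i => i.+1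
  | ENat _ => 0
  | ESucc e => var_bound e
  | EPair e1 e2 => maxn (var_bound e1) (var_bound e2)
  end.

Lemma eq_eval env env' e :
  (forall i, i < var_bound e -> env i = env' i) -> eval env e = eval env' e.
Proof.
elim: e => [i|c|e IH|e1 IH1 e2 IH2] //= eq_env; first exact: eq_env.
- by rewrite IH.
- by rewrite IH1 ?IH2 // => i lti; apply: eq_env; rewrite leq_max lti ?orbT.
Qed.

Lemma clause_project (env : nat -> nat) (C : clause) :
  exists n, forall sigma, clause_true sigma (project n) C = clause_true sigma env C.
Proof.
have [n nP] := project_surj env (\max_(e <- C.1 ++ C.2) var_bound e).
have in_bound es e : List.In e es -> var_bound e <= \max_(e <- es) var_bound e.
  elim: es => //= e' es IH [->|/IH le]; rewrite big_cons leq_max ?leqnn //.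
  by rewrite le orbT.
have evE e : List.In e (C.1 ++ C.2) -> eval (project n) e = eval env e.
  by move=> /in_bound le; apply: eq_eval => i lti; apply/nP/(leq_trans lti).
have E es : (forall e, List.In e es -> List.In e (C.1 ++ C.2)) ->
    map (eval (project n)) es = map (eval env) es.
  elim: es => //= e es IH sub; rewrite evE ?IH //; last by apply: sub; left.
  by move=> e' e'es; apply: sub; right.
exists n => sigma; rewrite /clause_true.
have allE f es : all (fun e => sigma (eval f e)) es = all sigma (map (eval f) es).
  by rewrite all_map.
have hasE f es : has (fun e => sigma (eval f e)) es = has sigma (map (eval f) es).
  by rewrite has_map.
rewrite !allE !hasE !E // => e eC; apply: List.in_or_app; [by right|by left].
Qed.

Variable G : seq clause.

Definition small (N n : nat) (C : clause) : bool :=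
  all (fun e => eval (project n) e < N) (C.1 ++ C.2).

Definition instance_ok (N b n : nat) : bool :=
  all (fun C => small N n C ==> clause_true (bit b) (project n) C) G.

(** A decidable approximation of level N: the bits of [b] make the queried atom true if it lies
    below N, and satisfy the clauses in all environments coded below N where their atoms lie below
    N. *)
Definition approx (x N b : nat) : bool :=
  ((npair 0 x < N) ==> bit b (npair 0 x)) && [forall n : 'I_N, instance_ok N b n].

Lemma rec_instance_ok k (N b n : k.-tuple nat -> nat) :
  recursive N -> recursive b -> recursive n ->
  recursive (fun v => instance_ok (N v) (b v) (n v) : nat).
Proof.
move=> RN Rb Rn.
apply: (@rec_all _ _ _ (fun C v =>
  small (N v) (n v) C ==> clause_true (bit (b v)) (project (n v)) C)) => C.
apply: rec_implb.
  apply: (@rec_all _ _ _ (fun e v => eval (project (n v)) e < N v)) => e.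
  by apply: rec_leq => //; apply/rec_succ'/rec_eval.
have Ratom e : recursive (fun v => bit (b v) (eval (project (n v)) e) : nat).
  by apply: rec_bit => //; apply: rec_eval.
apply: rec_implb.
  exact: (@rec_all _ _ _ (fun e v => bit (b v) (eval (project (n v)) e))).
exact: (@rec_has _ _ _ (fun e v => bit (b v) (eval (project (n v)) e))).
Qed.

Lemma rec_approx k (x N b : k.-tuple nat -> nat) :
  recursive x -> recursive N -> recursive b ->
  recursive (fun v => approx (x v) (N v) (b v) : nat).
Proof.
move=> Rx RN Rb; have Rq : recursive (fun v => npair 0 (x v)).
  by apply: rec_npair => //; apply: rec_zero.
apply: rec_and.
  by apply: rec_implb; [apply: rec_leq => //; apply: rec_succ'|apply: rec_bit].
apply: (rec_forall_lt (b := fun n v => instance_ok (N v) (b v) n)) => //.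
by apply: rec_instance_ok; [exact: rec_lift|exact: rec_lift|exact: rec_head].
Qed.

Let sat x N (sigma : nat -> bool) : Prop :=
  (npair 0 x < N -> sigma (npair 0 x)) /\
  forall n C, n < N -> List.In C G -> small N n C ->
    clause_true sigma (project n) C.

Let sat_local x N sigma tau :
  (forall i, i < N -> sigma i = tau i) -> sat x N sigma -> sat x N tau.
Proof.
move=> eq_st [root inst]; split=> [lt|n C ltn CG smallC].
  by rewrite -eq_st //; apply: root.
have := inst n C ltn CG smallC.
have E es : all (fun e => eval (project n) e < N) es ->
    map (fun e => sigma (eval (project n) e)) es =
    map (fun e => tau (eval (project n) e)) es.
  by elim: es => //= e es IH /andP [lt /IH ->]; rewrite eq_st.
move: smallC; rewrite /small all_cat => /andP [/E E1 /E E2].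
have allE (f : exp -> bool) es : all f es = all id (map f es) by rewrite all_map.
have hasE (f : exp -> bool) es : has f es = has id (map f es) by rewrite has_map.
by rewrite /clause_true !(allE (fun=> _)) !(hasE (fun=> _)) E1 E2.
Qed.

Lemma all_In T (p : T -> bool) s : all p s <-> forall x, List.In x s -> p x.
Proof.
elim: s => //= x s [IH1 IH2]; split=> [/andP [px /IH1 ps] y [<-|/ps]|ps] //.
by rewrite ps ?IH2 //; [move=> y ys; apply: ps; right|left].
Qed.

Let approxP x N b : approx x N b <-> sat x N (bit b).
Proof.
split=> [/andP [/implyP root /forallP inst]|[root inst]].
  split=> // n C ltn CG smallC.
  by have /all_In /(_ C CG) := inst (Ordinal ltn); rewrite smallC.
apply/andP; split; first exact/implyP.
by apply/forallP => n; apply/all_In => C CG; apply/implyP; apply: inst.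
Qed.

(** Only the numbers below 2^N have to be searched for an approximation of level N, so its existence
    is recursive; approximations at all levels combine by [konig]. *)
Lemma clauses_Pi01 :
  Pi01 [set x | exists2 sigma, clauses_true G sigma & sigma (npair 0 x)]%classic.
Proof.
pose R (v : 2.-tuple nat) :=
  [exists b : 'I_(2 ^ tnth v ord_max), approx (tnth v ord0) (tnth v ord_max) b].
exists R; split.
  apply: (rec_exists_lt
    (b := fun b (v : 2.-tuple nat) => approx (tnth v ord0) (tnth v ord_max) b)).
    exact/rec_exp2/rec_proj.
  apply: rec_approx; last exact: rec_head.
    exact: (rec_lift (rec_proj _)).
  exact: (rec_lift (rec_proj _)).
move=> x; split=> [[sigma Gsigma root] N|allR].
  have [b ltb bitE] := bit_surj N sigma.
  apply/existsP; exists (Ordinal ltb); apply/approxP.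
  apply: (@sat_local _ _ sigma) => [i ltiN|]; first by rewrite bitE.
  by split=> // n C _ CG _; apply: Gsigma.
have [|||sigma satsigma] := @konig (sat x).
- move=> N sigma [root inst]; split=> [lt|n C ltn CG smallC].
    by apply: root; apply: ltnW.
  apply: inst => //; first exact: ltnW.
  by apply: sub_all smallC => e; apply: leqW.
- exact: sat_local.
- by move=> N; have /existsP [b /approxP] := allR N; exists (bit b).
exists sigma; last by case: (satsigma (npair 0 x).+1) => root _; apply: root.
move=> env C CG; have [n <-] := clause_project env C.
(* This level exceeds the code of the environment and, through the sum, every atom of the instance,
   so the instance is checked at it. *)
pose N := (n + \sum_(e <- C.1 ++ C.2) eval (project n) e).+1.
apply: (proj2 (satsigma N)) => //; first by rewrite ltnS leq_addr.
apply/all_In => e; rewrite /N ltnS => eC.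
apply: leq_trans (leq_addl _ _); elim: (C.1 ++ C.2) eC => //= e' es IH.
rewrite big_cons; case=> [->|/IH le]; first exact: leq_addr.
exact: leq_trans le (leq_addl _ _).
Qed.

End ClausesPi01.

(** * Satisfiability as a set of clauses *)

Lemma leq_unpair2 n : unpair2 n <= n.
Proof. by rewrite -{2}(npairK n) (leq_trans _ (leq_npair _ _)) ?leq_addl. Qed.

(** A bijection with the natural numbers, so that every number stands for a tuple of constants; the
    successor keeps nonempty lists apart from 0. *)
Fixpoint lcode (s : seq nat) : nat :=
  if s is a :: s' then (npair a (lcode s')).+1 else 0.

(** The code of a tail is smaller than that of the list, so the number itself is enough fuel. *)
Fixpoint ldecode_fuel (fuel n : nat) : seq nat :=
  match fuel, n with
  | f.+1, m.+1 => unpair1 m :: ldecode_fuel f (unpair2 m)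
  | _, _ => [::]
  end.

Definition ldecode n := ldecode_fuel n n.

Lemma lcodeK : cancel lcode ldecode.
Proof.
move=> s; rewrite /ldecode.
suff E f : lcode s <= f -> ldecode_fuel f (lcode s) = s by apply: E.
elim: s f => [|a s IH] [|f] //= lef; rewrite unpair1E unpair2E IH //.
rewrite -ltnS; apply: leq_trans lef; rewrite ltnS.
by apply: leq_trans (leq_npair a _); apply: leq_addl.
Qed.

Lemma ldecodeK : cancel ldecode lcode.
Proof.
move=> n; rewrite /ldecode.
suff E f : n <= f -> lcode (ldecode_fuel f n) = n by apply: E.
elim: f n => [|f IH] [|n] //= lef.
by rewrite IH ?npairK //; apply: leq_trans (leq_unpair2 n) lef.
Qed.

Lemma ldecode_cons a u : ldecode (npair a u).+1 = a :: ldecode u.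
Proof. by rewrite -{1}(ldecodeK u) -[(npair _ _).+1]/(lcode (a :: _)) lcodeK. Qed.

(** This makes the definition of the Skolem constants well-founded: the constant for a projection at
    u refers only to constants with smaller numbers. *)
Lemma ldecode_lt u x : x \in ldecode u -> x < u.
Proof.
rewrite -{2}(ldecodeK u); elim: (ldecode u) => //= a s IH.
rewrite inE ltnS => /orP [/eqP ->|/IH ltx].
  by rewrite (leq_trans _ (leq_npair _ _)) ?leq_addr.
apply: leq_trans (ltnW ltx) _; apply: leq_trans (leq_npair a _).
exact: leq_addl.
Qed.

Section Clauses.

Let eT := EVar 0.
Let eS := EVar 1.
Let eu := EVar 2.
Let ev := EVar 3.
Let ew := EVar 4.
Let ea := EVar 5.
Let eb := EVar 6.
Let enil := ENat 0.
Let econs a u := ESucc (EPair a u).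
Let eRel k i := EPair (ENat 0) (EPair k i).
Let eEq := EPair (ENat 1) (ENat 0).
Let ePerm t := EPair (ENat 2) t.
Let eIdent t := EPair (ENat 3) t.
Let eNeg t := EPair (ENat 4) t.
Let eJoin t s := EPair (ENat 5) (EPair t s).
Let eExists t := EPair (ENat 6) t.
Let nonempty t := EPair (ENat 0) t.
Let val t u := EPair (ENat 1) (EPair t u).
Let len t u := EPair (ENat 2) (EPair t u).
Let cat u v w := EPair (ENat 3) (EPair u (EPair v w)).
Let wf t := EPair (ENat 4) t.

(* The intended reading of the atoms: [nonempty T]: T denotes a nonempty relation;
   [val T u]: the tuple of constants u belongs to T; [len T u]: u has the arity
   of T; [cat u v w]: w is the concatenation of u and v; [wf T]: T codes a term.
   The constant [npair T u] is a Skolem witness for [TExists T] at u. *)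
Definition gra_clauses : seq clause :=
  [:: ([::], [:: len (eRel enil ea) enil]);
      ([:: len (eRel eb ea) eu], [:: len (eRel (ESucc eb) ea) (econs ew eu)]);
      ([::], [:: len eEq (econs ea (econs eb enil))]);
      ([:: len eT eu], [:: len (ePerm eT) eu]);
      ([:: len eT (econs ea (econs eb eu))], [:: len (eIdent eT) (econs eb eu)]);
      ([:: len eT (econs ea enil)], [:: len (eIdent eT) (econs ea enil)]);
      ([:: len eT enil], [:: len (eIdent eT) enil]);
      ([:: len eT eu], [:: len (eNeg eT) eu]);
      ([:: len eT eu; len eS ev; cat ev eu ew], [:: len (eJoin eT eS) ew]);
      ([:: len eT (econs ea eu)], [:: len (eExists eT) eu]);
      ([:: len eT enil], [:: len (eExists eT) enil]);
      ([::], [:: cat enil ev ev]);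
      ([:: cat eu ev ew], [:: cat (econs ea eu) ev (econs ea ew)]);
      ([::], [:: val eEq (econs ea (econs ea enil))]);
      ([:: val eEq (econs ea (econs eb enil)); val eT (econs ea eu)],
       [:: val eT (econs eb eu)]);
      ([:: cat eu (econs ea enil) ew; val (ePerm eT) ew],
       [:: val eT (econs ea eu)]);
      ([:: cat eu (econs ea enil) ew; val eT (econs ea eu)],
       [:: val (ePerm eT) ew]);
      ([:: val (ePerm eT) enil], [:: val eT enil]);
      ([:: val eT enil], [:: val (ePerm eT) enil]);
      ([:: len eT (econs ea (econs ea eu)); val (eIdent eT) (econs ea eu)],
       [:: val eT (econs ea (econs ea eu))]);
      ([:: val eT (econs ea (econs ea eu))], [:: val (eIdent eT) (econs ea eu)]);
      ([:: len eT (econs ea enil); val (eIdent eT) (econs ea enil)],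
       [:: val eT (econs ea enil)]);
      ([:: val eT (econs ea enil)], [:: val (eIdent eT) (econs ea enil)]);
      ([:: val (eIdent eT) enil], [:: val eT enil]);
      ([:: val eT enil], [:: val (eIdent eT) enil]);
      ([:: val (eNeg eT) eu; val eT eu], [::]);
      ([:: len eT eu], [:: val eT eu; val (eNeg eT) eu]);
      ([:: len eT eu; len eS ev; cat ev eu ew; val (eJoin eT eS) ew],
       [:: val eT eu]);
      ([:: len eT eu; len eS ev; cat ev eu ew; val (eJoin eT eS) ew],
       [:: val eS ev]);
      ([:: cat ev eu ew; val eT eu; val eS ev], [:: val (eJoin eT eS) ew]);
      ([:: val eT (econs ea eu)], [:: val (eExists eT) eu]);
      ([:: len eT (econs ea eu); val (eExists eT) eu],
       [:: val eT (econs (EPair eT eu) eu)]);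
      ([:: len eT enil; val (eExists eT) enil], [:: val eT enil]);
      ([:: val eT enil], [:: val (eExists eT) enil]);
      ([:: nonempty eT; len eT (econs ea eu)], [:: nonempty (eExists eT)]);
      ([:: nonempty eT; len eT enil], [:: val eT enil]);
      ([:: nonempty eT], [:: wf eT]);
      ([:: wf (EPair (ENat 1) (ESucc ea))], [::]);
      ([:: wf (ePerm eT)], [:: wf eT]);
      ([:: wf (eIdent eT)], [:: wf eT]);
      ([:: wf (eNeg eT)], [:: wf eT]);
      ([:: wf (eJoin eT eS)], [:: wf eT]);
      ([:: wf (eJoin eT eS)], [:: wf eS]);
      ([:: wf (eExists eT)], [:: wf eT]);
      ([:: wf (EPair (iter 7 ESucc ea) eb)], [::])].

End Clauses.

Section ClauseProp.
Variables (sigma : nat -> Prop) (env : nat -> nat).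

(** A single conclusion stays a bare atom, so that a clause instance is convertible to the
    implication it expresses. *)
Fixpoint disj (qs : seq exp) : Prop :=
  match qs with
  | [::] => False
  | [:: q] => sigma (eval env q)
  | q :: qs => sigma (eval env q) \/ disj qs
  end.

Definition clause_prop (C : clause) : Prop :=
  foldr (fun p P => sigma (eval env p) -> P) (disj C.2) C.1.

End ClauseProp.

Lemma clause_propP (sigma : nat -> bool) env C :
  clause_true sigma env C <-> clause_prop sigma env C.
Proof.
case: C => ps qs; rewrite /clause_true /clause_prop /=.
have disjP : has (fun e => sigma (eval env e)) qs <-> disj sigma env qs.
  elim: qs => //= q [|q' qs] IH; first by rewrite orbF.
  by rewrite -IH; split=> [/orP|/orP] //.
by elim: ps => //= p ps <-; case: (sigma _); intuition.
Qed.

Section TermCodes.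
Implicit Types (T S : nat) (P : term -> Prop).

(** False for numbers that code no term. Its laws below are equations between propositions, by which
    a clause is rewritten into a statement about terms. *)
Definition decodes T P : Prop := exists2 t, T = code t & P t.

Lemma decodes_code t P : decodes (code t) P = P t.
Proof. by apply/propext; split=> [[t' /code_inj ->]|]; [|exists t]. Qed.

Lemma decodes_unary n F T P :
  (forall t, code (F t) = npair n (code t)) ->
  (forall t S, npair n S = code t -> exists2 t', t = F t' & S = code t') ->
  decodes (npair n T) P = decodes T (P \o F).
Proof.
move=> codeF invF; apply/propext; split=> [[t /invF [t' -> ->] Pt]|[t -> Pt]].
  by exists t'.
by exists (F t).
Qed.

Ltac code_inversion :=
  case=> [k i||t|t|t|t s|t] S //= /npair_inj [] // _ ->; by eexists.

Lemma decodes_perm T P : decodes (npair 2 T) P = decodes T (P \o TPerm).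
Proof. by apply: decodes_unary => //; code_inversion. Qed.

Lemma decodes_ident T P : decodes (npair 3 T) P = decodes T (P \o TIdent).
Proof. by apply: decodes_unary => //; code_inversion. Qed.

Lemma decodes_neg T P : decodes (npair 4 T) P = decodes T (P \o TNeg).
Proof. by apply: decodes_unary => //; code_inversion. Qed.

Lemma decodes_exists T P : decodes (npair 6 T) P = decodes T (P \o TExists).
Proof. by apply: decodes_unary => //; code_inversion. Qed.

Lemma decodes_rel k i P : decodes (npair 0 (npair k i)) P = P (TRel k i).
Proof. exact: (decodes_code (TRel k i)). Qed.

Lemma decodes_eq P : decodes (npair 1 0) P = P TEq.
Proof. exact: (decodes_code TEq). Qed.

Lemma decodes_join T S P :
  decodes (npair 5 (npair T S)) P =
  decodes T (fun t => decodes S (fun s => P (TJoin t s))).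
Proof.
apply/propext; split=> [[]|[t -> [s -> Pts]]]; last by exists (TJoin t s).
case=> [k i||t|t|t|t s|t] //= /npair_inj [] // _ /npair_inj [-> ->] Pts.
by exists t => //; exists s.
Qed.

Lemma decodes_eq_succ n P : decodes (npair 1 n.+1) P = False.
Proof.
apply/propext; split=> // -[].
by case=> [k i||t|t|t|t s|t] //= /npair_inj [].
Qed.

Lemma decodes_tag n m P : decodes (npair n.+4.+3 m) P = False.
Proof.
apply/propext; split=> // -[].
by case=> [k i||t|t|t|t s|t] //= /npair_inj [].
Qed.

Lemma codeP T : (exists t, T = code t) \/ forall P, decodes T P = False.
Proof.
case: (pselect (exists t, T = code t)) => [|no]; [by left|right=> P].
by apply/propext; split=> // -[t eT _]; case: no; exists t.
Qed.

End TermCodes.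

Section Skolem.
Variables (A : Type) (a0 : A) (I : nat -> nat -> seq A -> Prop).

Let pick (P : A -> Prop) : A :=
  if pselect (exists a, P a) is left ex then projT1 (cid ex) else a0.

Let pickP P : (exists a, P a) -> P (pick P).
Proof. by rewrite /pick; case: pselect => // ex _; case: cid. Qed.

(** A witness for the projection of the term and list coded by n, with g supplying the constants in
    that list. *)
Let choose (g : nat -> A) (n : nat) : A := pick (fun a => decodes (unpair1 n)
  (fun t => rsem I t (a :: map g (ldecode (unpair2 n))))).

Let choose_local g h n :
  (forall m, m < n -> g m = h m) -> choose g n = choose h n.
Proof.
move=> eq_gh; rewrite /choose.
have -> // : map g (ldecode (unpair2 n)) = map h (ldecode (unpair2 n)).
apply/eq_in_map => m /ldecode_lt ltm; apply: eq_gh.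
exact: leq_trans ltm (leq_unpair2 n).
Qed.

(** Course-of-values recursion: [choose] at n consults only constants below n, so any fuel above n
    gives the same value. *)
Lemma skolem_constants : exists c : nat -> A, forall t u,
  (exists a, rsem I t (a :: map c (ldecode u))) ->
  rsem I t (c (npair (code t) u) :: map c (ldecode u)).
Proof.
pose cf := fix cf k n := if k is k'.+1 then choose (cf k') n else a0.
have stable k : forall l n, n < k -> n < l -> cf k n = cf l n.
  elim: k => // k IH [|l] n //= ltk ltl; apply: choose_local => m ltm.
  by apply: IH; apply: leq_trans ltm _.
pose c n := cf n.+1 n.
have cE n : c n = choose c n.
  by apply: choose_local => m ltm; apply: stable.
exists c => t u [a ta]; rewrite cE /choose unpair1E unpair2E.
set P := fun _ => _.
have : P (pick P) by apply: pickP; exists a; rewrite /P decodes_code.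
by rewrite /P decodes_code.
Qed.

End Skolem.

Section ModelToAssignment.
Variables (A : Type) (I : nat -> nat -> seq A -> Prop) (c : nat -> A).
Hypothesis skolem : forall t u,
  (exists a, rsem I t (a :: map c (ldecode u))) ->
  rsem I t (c (npair (code t) u) :: map c (ldecode u)).

Let holds (n : nat) : Prop :=
  let y := unpair2 n in let x1 := unpair1 y in let x2 := unpair2 y in
  match unpair1 n with
  | 0 => decodes y (fun t => exists s, rsem I t s)
  | 1 => decodes x1 (fun t => rsem I t (map c (ldecode x2)))
  | 2 => decodes x1 (fun t => arity t = size (ldecode x2))
  | 3 => ldecode (unpair2 x2) = ldecode x1 ++ ldecode (unpair1 x2)
  | _ => decodes y (fun=> True)
  end.

Let holds0 T : holds (npair 0 T) = decodes T (fun t => exists s, rsem I t s).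
Proof. by rewrite /holds !unpair1E !unpair2E. Qed.

Let holds1 T u : holds (npair 1 (npair T u)) =
  decodes T (fun t => rsem I t (map c (ldecode u))).
Proof. by rewrite /holds unpair1E !unpair2E unpair1E. Qed.

Let holds2 T u : holds (npair 2 (npair T u)) =
  decodes T (fun t => arity t = size (ldecode u)).
Proof. by rewrite /holds unpair1E !unpair2E unpair1E. Qed.

Let holds3 u v w : holds (npair 3 (npair u (npair v w))) =
  (ldecode w = ldecode u ++ ldecode v).
Proof. by rewrite /holds unpair1E !unpair2E !unpair1E. Qed.

Let holds4 T : holds (npair 4 T) = decodes T (fun=> True).
Proof. by rewrite /holds !unpair1E !unpair2E. Qed.

Let holdsE := (holds0, holds1, holds2, holds3, holds4, decodes_perm,
  decodes_ident, decodes_neg, decodes_exists, decodes_rel, decodes_eq,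
  decodes_join, decodes_eq_succ, decodes_tag, ldecode_cons).

Lemma gra_clauses_sound env C : List.In C gra_clauses -> clause_prop holds env C.
Proof.
rewrite /gra_clauses.
do 45?[case=> [<-|]]; last by [].
all: rewrite /clause_prop /= !holdsE /=.
all: move: (env 0) (env 1) (env 2) (env 3) (env 4) (env 5) (env 6).
all: move=> T S u v w a b.
all: try by [move=> -> | exists (c a)].
(* If T codes no term, all atoms about T are false and the clauses with such a premise hold
   vacuously. *)
all: case: (codeP T) => [[t eT]|noT]; rewrite ?eT ?decodes_code ?noT //=.
all: try by [case | move=> ->].
- case: (codeP S) => [[s eS]|noS]; rewrite ?eS ?decodes_code ?noS //.
  by move=> -> -> ->; rewrite size_cat addnC.
- by case=> x [-> ->].
- by move=> ->; rewrite map_cat cats1 rotr1_rcons.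
- by move=> ->; rewrite map_cat cats1 rotr1_rcons.
- by move=> tu; have /= <- := rsem_size tu.
- by move=> tu; have /= <- := rsem_size tu.
- by case: ifP.
- by move=> tu; have /= <- := rsem_size tu.
- by move=> ar; case: (pselect (rsem I t (map c (ldecode u)))) => nt;
    [left|right; rewrite size_map ar].
- case: (codeP S) => [[s eS]|noS]; rewrite ?eS ?decodes_code ?noS //.
  move=> art ars -> [u' [v' [eq_w tu sv]]]; suff -> : map c (ldecode u) = u' by [].
  (* In reversed order the second factor comes first and has length [arity s], so cutting there
     determines both factors. *)
  move/(congr1 (drop (arity s))): eq_w.
  by rewrite map_cat !drop_size_cat ?size_map // (rsem_size sv).
- case: (codeP S) => [[s eS]|noS]; rewrite ?eS ?decodes_code ?noS //.
  move=> art ars -> [u' [v' [eq_w tu sv]]]; suff -> : map c (ldecode v) = v' by [].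
  move/(congr1 (take (arity s))): eq_w.
  by rewrite map_cat !take_size_cat ?size_map // (rsem_size sv).
- move=> -> tu; case: (codeP S) => [[s eS]|noS]; rewrite ?eS ?decodes_code ?noS //.
  by move=> sv; exists (map c (ldecode u)), (map c (ldecode v)); rewrite map_cat.
- by move=> tu; have /= <- := rsem_size tu; exists (c a).
- by move=> ->; apply: skolem.
- by move=> t0; have /= <- := rsem_size t0.
- case=> [s ts] ar; exists (behead s); rewrite ar.
  by have := rsem_size ts; rewrite ar; case: s ts => // a' s ts; exists a'.
- by case=> s ts ar; have := rsem_size ts; rewrite ar => /size0nil <-.
Qed.
End ModelToAssignment.

Section AssignmentToModel.
Variable sigma : nat -> bool.
Hypothesis sigmaG : clauses_true gra_clauses sigma.

Let nonempty T := sigma (npair 0 T).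
Let V T u := sigma (npair 1 (npair T u)).
Let len T u := sigma (npair 2 (npair T u)).
Let cat u v w := sigma (npair 3 (npair u (npair v w))).
Let wf T := sigma (npair 4 T).
Let cons a u := (npair a u).+1.

(** The list [s] gives the values of T, S, u, v, w, a, b in this order, with 0 for missing entries;
    the rules below are the clauses read off one by one. *)
Let rule s n :
  n < size gra_clauses ->
  clause_prop sigma (nth 0 s) (nth ([::], [::]) gra_clauses n).
Proof.
move=> ltn; apply/clause_propP/sigmaG.
elim: gra_clauses n ltn => // C G IH [|n] ltn; first by left.
by right; apply: IH.
Qed.

Local Opaque npair.

Let len_rel0 i : len (npair 0 (npair 0 i)) 0.
Proof. exact: (@rule [:: 0; 0; 0; 0; 0; i] 0 isT). Qed.

Let len_relS k i u a :
  len (npair 0 (npair k i)) u -> len (npair 0 (npair k.+1 i)) (cons a u).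
Proof. exact: (@rule [:: 0; 0; u; 0; a; i; k] 1 isT). Qed.

Let len_eq a b : len (npair 1 0) (cons a (cons b 0)).
Proof. exact: (@rule [:: 0; 0; 0; 0; 0; a; b] 2 isT). Qed.

Let len_perm T u : len T u -> len (npair 2 T) u.
Proof. exact: (@rule [:: T; 0; u] 3 isT). Qed.

Let len_ident T u a b :
  len T (cons a (cons b u)) -> len (npair 3 T) (cons b u).
Proof. exact: (@rule [:: T; 0; u; 0; 0; a; b] 4 isT). Qed.

Let len_ident1 T a : len T (cons a 0) -> len (npair 3 T) (cons a 0).
Proof. exact: (@rule [:: T; 0; 0; 0; 0; a] 5 isT). Qed.

Let len_ident0 T : len T 0 -> len (npair 3 T) 0.
Proof. exact: (@rule [:: T] 6 isT). Qed.

Let len_neg T u : len T u -> len (npair 4 T) u.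
Proof. exact: (@rule [:: T; 0; u] 7 isT). Qed.

Let len_join T S u v w :
  len T u -> len S v -> cat v u w -> len (npair 5 (npair T S)) w.
Proof. exact: (@rule [:: T; S; u; v; w] 8 isT). Qed.

Let len_exists T a u : len T (cons a u) -> len (npair 6 T) u.
Proof. exact: (@rule [:: T; 0; u; 0; 0; a] 9 isT). Qed.

Let len_exists0 T : len T 0 -> len (npair 6 T) 0.
Proof. exact: (@rule [:: T] 10 isT). Qed.

Let cat_nil v : cat 0 v v.
Proof. exact: (@rule [:: 0; 0; 0; v] 11 isT). Qed.

Let cat_cons a u v w : cat u v w -> cat (cons a u) v (cons a w).
Proof. exact: (@rule [:: 0; 0; u; v; w; a] 12 isT). Qed.

Let V_refl a : V (npair 1 0) (cons a (cons a 0)).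
Proof. exact: (@rule [:: 0; 0; 0; 0; 0; a] 13 isT). Qed.

Let V_congr T a b u :
  V (npair 1 0) (cons a (cons b 0)) -> V T (cons a u) -> V T (cons b u).
Proof. exact: (@rule [:: T; 0; u; 0; 0; a; b] 14 isT). Qed.

Let V_perm T a u w : cat u (cons a 0) w -> V (npair 2 T) w = V T (cons a u).
Proof.
move=> c; apply/idP/idP; move: c.
  exact: (@rule [:: T; 0; u; 0; w; a] 15 isT).
exact: (@rule [:: T; 0; u; 0; w; a] 16 isT).
Qed.

Let V_perm0 T : V (npair 2 T) 0 = V T 0.
Proof. apply/idP/idP; [exact: (@rule [:: T] 17 isT)|
  exact: (@rule [:: T] 18 isT)]. Qed.

Let V_ident T a u : len T (cons a (cons a u)) ->
  V (npair 3 T) (cons a u) = V T (cons a (cons a u)).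
Proof.
move=> l; apply/idP/idP; last exact: (@rule [:: T; 0; u; 0; 0; a] 20 isT).
move: l; exact: (@rule [:: T; 0; u; 0; 0; a] 19 isT).
Qed.

Let V_ident1 T a : len T (cons a 0) -> V (npair 3 T) (cons a 0) = V T (cons a 0).
Proof.
move=> l; apply/idP/idP; last exact: (@rule [:: T; 0; 0; 0; 0; a] 22 isT).
move: l; exact: (@rule [:: T; 0; 0; 0; 0; a] 21 isT).
Qed.

Let V_ident0 T : V (npair 3 T) 0 = V T 0.
Proof. apply/idP/idP; [exact: (@rule [:: T] 23 isT)|exact: (@rule [:: T] 24 isT)]. Qed.

Let V_neg T u : len T u -> V (npair 4 T) u = ~~ V T u.
Proof.
move=> l; case E: (V T u); last first.
  have : V T u \/ V (npair 4 T) u by move: l; exact: (@rule [:: T; 0; u] 26 isT).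
  by rewrite E; case.
apply/negP => nE; move: nE E; exact: (@rule [:: T; 0; u] 25 isT).
Qed.

Let V_join T S u v w : len T u -> len S v -> cat v u w ->
  V (npair 5 (npair T S)) w = V T u && V S v.
Proof.
move=> lT lS c; apply/idP/andP => [J|[]].
  split; move: lT lS c J; first exact: (@rule [:: T; S; u; v; w] 27 isT).
  exact: (@rule [:: T; S; u; v; w] 28 isT).
move: c; exact: (@rule [:: T; S; u; v; w] 29 isT).
Qed.

Let V_exists T a u : V T (cons a u) -> V (npair 6 T) u.
Proof. exact: (@rule [:: T; 0; u; 0; 0; a] 30 isT). Qed.

Let V_witness T a u :
  len T (cons a u) -> V (npair 6 T) u -> V T (cons (npair T u) u).
Proof. exact: (@rule [:: T; 0; u; 0; 0; a] 31 isT). Qed.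

Let V_exists0 T : len T 0 -> V (npair 6 T) 0 = V T 0.
Proof.
move=> l; apply/idP/idP; last exact: (@rule [:: T] 33 isT).
move: l; exact: (@rule [:: T] 32 isT).
Qed.

Let nonempty_exists T a u : nonempty T -> len T (cons a u) -> nonempty (npair 6 T).
Proof. exact: (@rule [:: T; 0; u; 0; 0; a] 34 isT). Qed.

Let nonempty0 T : nonempty T -> len T 0 -> V T 0.
Proof. exact: (@rule [:: T] 35 isT). Qed.

Let nonempty_wf T : nonempty T -> wf T.
Proof. exact: (@rule [:: T] 36 isT). Qed.

Let wf_eq n : wf (npair 1 n.+1) -> False.
Proof. exact: (@rule [:: 0; 0; 0; 0; 0; n] 37 isT). Qed.

Let wf_perm T : wf (npair 2 T) -> wf T.
Proof. exact: (@rule [:: T] 38 isT). Qed.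

Let wf_ident T : wf (npair 3 T) -> wf T.
Proof. exact: (@rule [:: T] 39 isT). Qed.

Let wf_neg T : wf (npair 4 T) -> wf T.
Proof. exact: (@rule [:: T] 40 isT). Qed.

Let wf_joinl T S : wf (npair 5 (npair T S)) -> wf T.
Proof. exact: (@rule [:: T; S] 41 isT). Qed.

Let wf_joinr T S : wf (npair 5 (npair T S)) -> wf S.
Proof. exact: (@rule [:: T; S] 42 isT). Qed.

Let wf_exists T : wf (npair 6 T) -> wf T.
Proof. exact: (@rule [:: T] 43 isT). Qed.

Let wf_tag n T : wf (npair n.+4.+3 T) -> False.
Proof. exact: (@rule [:: 0; 0; 0; 0; 0; n; T] 44 isT). Qed.

Local Transparent npair.

(** Descent on codes: for tags 2 to 6 well-formedness passes to smaller numbers, tag 0 always gives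
    a relation symbol, tag 1 gives only [e], and higher tags are excluded. *)
Let wf_code T : wf T -> exists t, T = code t.
Proof.
elim/ltn_ind: T => T IH.
have small i y : i + y <= npair i y by apply: leq_npair.
rewrite -[T]npairK; move: (unpair1 T) (unpair2 T) (npairK T) => i y eT.
have {}IH x : 0 < i -> x <= y -> wf x -> exists t, x = code t.
  move=> i_gt0 lex; apply: IH; rewrite -eT; apply: leq_trans (small i y).
  by rewrite -add1n leq_add.
case: i {small} eT IH => [|[|[|[|[|[|[|i]]]]]]] eT IH.
- by move=> _; exists (TRel (unpair1 y) (unpair2 y)); rewrite /= npairK.
- by case: y {eT IH} => [|n] => [_|/wf_eq //]; exists TEq.
- by move=> /wf_perm /IH [] // t ->; exists (TPerm t).
- by move=> /wf_ident /IH [] // t ->; exists (TIdent t).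
- by move=> /wf_neg /IH [] // t ->; exists (TNeg t).
- rewrite -[y]npairK => wf_y.
  have le1 : unpair1 y <= y.
    by rewrite -{2}(npairK y) (leq_trans _ (leq_npair _ _)) ?leq_addr.
  have [t et] := IH (unpair1 y) isT le1 (wf_joinl wf_y).
  have [s es] := IH (unpair2 y) isT (leq_unpair2 y) (wf_joinr wf_y).
  by exists (TJoin t s); rewrite et es.
- by move=> /wf_exists /IH [] // t ->; exists (TExists t).
- by move/wf_tag.
Qed.

Let cat_code s r : cat (lcode s) (lcode r) (lcode (s ++ r)).
Proof. by elim: s => [|a s IH]; [apply: cat_nil|apply: cat_cons]. Qed.

(** The clauses for arity and concatenation are closure conditions, so they force the atoms that are
    true in the intended reading. This discharges such premises in the clauses on membership. *)
Let len_code t s : size s = arity t -> len (code t) (lcode s).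
Proof.
elim: t s => [k i||t IH|t IH|t IH|t IHt t' IHt'|t IH] s /=.
- elim: s k => [|a s IH] [|k] //= [eq_s]; exact/len_relS/IH.
- by case: s => [|a [|b []]] // _; apply: len_eq.
- by move/IH; apply: len_perm.
- case: (arity t) IH => [|[|k]] IH size_s.
  + by move: size_s => /size0nil ->; apply/len_ident0/(IH [::]).
  + by case: s size_s => [|a []] // _; apply/len_ident1/(IH [:: a]).
  + case: s size_s => // a s [size_s]; apply: (@len_ident _ _ a).
    by apply: (IH [:: a, a & s]); rewrite /= size_s.
- by move/IH; apply: len_neg.
- move=> size_s; rewrite -(cat_take_drop (arity t') s).
  apply: len_join (IHt (drop (arity t') s) _) (IHt' (take (arity t') s) _) _.
  + by rewrite size_drop size_s addnK.
  + by rewrite size_takel // size_s leq_addl.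
  + exact: cat_code.
- case: (arity t) IH => [|k] IH /= size_s.
    by move: size_s => /size0nil ->; apply/len_exists0/(IH [::]).
  (* Any constant may fill the projected position; 0 is taken. *)
  by apply: (@len_exists _ 0); apply: (IH (0 :: s)); rewrite /= size_s.
Qed.

Let E a b := V (npair 1 0) (cons a (cons b 0)).

(** Congruence at the head, applied to the reflexivity atom of equality itself. *)
Let E_sym a b : E a b -> E b a.
Proof. by move=> Eab; apply: V_congr Eab (V_refl a). Qed.

Let E_trans a b c : E a b -> E b c -> E a c.
Proof. by move=> /E_sym; apply: V_congr. Qed.

(** The least constant of the class; two representatives that are equal in the sense of [E] are then
    identical. *)
Let rep (a : nat) : nat := ex_minn (ex_intro (E a) a (V_refl a)).

Let E_rep a : E a (rep a).
Proof. by rewrite /rep; case: ex_minnP. Qed.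

Let rep_eq a b : E a b -> rep a = rep b.
Proof.
move=> Eab; rewrite /rep; case: ex_minnP => m Eam minm.
case: ex_minnP => n Ebn minn; apply/eqP; rewrite eqn_leq minm ?minn //.
  exact: E_trans (E_sym Eab) Eam.
exact: E_trans Eab Ebn.
Qed.

Let D := {a : nat | rep a == a}.

Let rep_idem a : rep (rep a) == rep a.
Proof. by apply/eqP/esym/rep_eq/E_rep. Qed.

Let repD (a : nat) : D := exist _ (rep a) (rep_idem a).

Let vals (s : seq D) : nat := lcode (map val s).

Let interp k i (s : seq D) : Prop := V (npair 0 (npair k i)) (vals s).

(** The truth lemma of the Henkin construction, by induction on [t]. *)
Let truth t (s : seq D) :
  size s = arity t -> (rsem interp t s <-> V (code t) (vals s)).
Proof.
elim: t s => [k i||t IH|t IH|t IH|t IHt t' IHt'|t IH] s /=.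
- by move=> size_s; split=> [[]|].
- case: s => [|a [|b []]] // _; split=> [[c [-> ->]]|Eab]; first exact: V_refl.
  exists a; congr [:: _; _]; apply: val_inj => /=.
  by rewrite -(eqP (valP a)) -(eqP (valP b)); apply/esym/rep_eq.
- case: (lastP s) => [|{}s a] size_s; first by rewrite IH // [V (npair 2 _) _]V_perm0.
  rewrite rotr1_rcons IH /=; last by rewrite -size_s size_rcons.
  rewrite (@V_perm _ (val a) (vals s)) //.
  by rewrite /vals map_rcons -cats1; apply: cat_code.
- case: (arity t) IH (len_code (t := t)) => [|[|k]] /= IH lenP size_s.
  + by rewrite (size0nil size_s) IH // [V (npair 3 _) _]V_ident0.
  + case: s size_s => [|a []] // _; rewrite IH // [V (npair 3 _) _]V_ident1 //.
    exact: (lenP [:: _]).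
  + case: s size_s => // a s [size_s].
    rewrite IH /= ?size_s // [V (npair 3 _) _]V_ident //.
    by apply: (lenP [:: val a, val a & map val s]); rewrite /= size_map size_s.
- move=> size_s; rewrite V_neg; last by apply: len_code; rewrite size_map.
  split=> [[_ nt]|/negP nt]; first by apply/negP => /IH -/(_ size_s).
  by split=> // /IH -/(_ size_s).
- move=> size_s; have sd : size (drop (arity t') s) = arity t.
    by rewrite size_drop size_s addnK.
  have st : size (take (arity t') s) = arity t'.
    by rewrite size_takel // size_s leq_addl.
  rewrite (@V_join _ _ (vals (drop (arity t') s)) (vals (take (arity t') s))).
  + split=> [[u [v [eq_s tu tv]]]|/andP [/(IHt _ sd) tu /(IHt' _ st) tv]].
      rewrite eq_s -(rsem_size tv) drop_size_cat // take_size_cat //.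
      apply/andP; split; first exact/(IHt _ (rsem_size tu)).
      exact/(IHt' _ (rsem_size tv)).
    exists (drop (arity t') s), (take (arity t') s).
    by rewrite cat_take_drop.
  + by apply: len_code; rewrite size_map.
  + by apply: len_code; rewrite size_map.
  + by rewrite -{3}(cat_take_drop (arity t') s) /vals map_cat; apply: cat_code.
- case: (arity t) IH (len_code (t := t)) => [|k] /= IH lenP size_s.
    rewrite (size0nil size_s) IH // [V (npair 6 _) _]V_exists0 //.
    exact: (lenP [::]).
  split=> [[a /IH]|ex_s].
    by rewrite /= size_s => /(_ erefl); apply: V_exists.
  have : V (code t) (cons (npair (code t) (vals s)) (vals s)).
    apply: (@V_witness _ 0) => //.
    by apply: (lenP (0 :: map val s)); rewrite /= size_map size_s.
  (* The Skolem witness need not be a representative, but it sits at the head, where congruence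
     replaces it by its representative. *)
  move/(V_congr (E_rep _)) => w_s; exists (repD (npair (code t) (vals s))).
  by apply/IH => //=; rewrite size_s.
Qed.

Lemma gra_clauses_complete T : sigma (npair 0 T) ->
  exists2 t, T = code t &
    exists2 A : Type, inhabited A &
      exists (I : nat -> nat -> seq A -> Prop) (s : seq A), rsem I t s.
Proof.
move=> neT; have [t eT] := wf_code (nonempty_wf neT); exists t => //.
exists D; first exact: (inhabits (repD 0)).
exists interp; move: neT; rewrite {T}eT -/(nonempty _).
move def_n: (arity t) => n.
(* Induction on the arity: nonemptiness passes to the projection until arity 0, where the empty
   tuple must belong. *)
elim: n t def_n => [|n IH] t art ne_t.
  exists [::]; apply/truth; rewrite ?art //; apply: nonempty0 => //.
  by apply: (len_code (s := [::])); rewrite art.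
have [||s] := IH (TExists t); rewrite /= ?art //.
  apply: (@nonempty_exists _ 0 (lcode (nseq n 0))) => //.
  by apply: (len_code (s := 0 :: nseq n 0)); rewrite /= size_nseq.
by case=> a; exists (a :: s).
Qed.

End AssignmentToModel.

Lemma GRA_SAT_Pi01 : Pi01 GRA_SAT.
Proof.
have [R [recR RE]] := clauses_Pi01 gra_clauses; exists R; split=> // T.
rewrite -RE; split=> [[t /satisfiableE [A [a0] [I [s ts]]] <-]|].
  have [c skolem] := skolem_constants a0 I.
  have := gra_clauses_sound skolem.
  set P := (P in clause_prop P) => PG.
  have Pb : P = (fun n => `[< P n >] : Prop).
    by apply/funext => n; apply/propext; split=> /asboolP.
  exists (fun n => `[< P n >]).
    by move=> env C CG; apply/clause_propP; rewrite -Pb; apply: PG.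
  apply/asboolP; rewrite /P /= unpair1E unpair2E decodes_code.
  by exists s.
move=> [sigma sigmaG root].
have [t -> tsat] := gra_clauses_complete sigmaG root.
by exists t => //; apply/satisfiableE.
Qed.

(** * The calculus of relations *)

Section RelationAlgebra.
Variables (A : Type) (I : nat -> nat -> seq A -> Prop).
Implicit Types t s : term.

(** Since lists are reversed tuples, this is the converse of the relation denoted by [t]. *)
Definition rel_of t (a b : A) : Prop := rsem I t [:: a; b].

Lemma rel_perm t a b : rel_of (TPerm t) a b <-> rel_of t b a.
Proof. by []. Qed.

Lemma rel_eq a b : rel_of TEq a b <-> a = b.
Proof. by split=> [[c [-> ->]]|->] //; exists b. Qed.

Lemma rel_neg t a b : arity t = 2 -> rel_of (TNeg t) a b <-> ~ rel_of t a b.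
Proof. by move=> art; rewrite /rel_of /= art; split=> [[]|]. Qed.

Lemma rsem_join2 t s w x y z : arity t = 2 -> arity s = 2 ->
  rsem I (TJoin t s) [:: x; y; z; w] <-> rel_of s x y /\ rel_of t z w.
Proof.
move=> art ars; split=> [[u [v [eq_s tu sv]]]|[sxy tzw]].
  have := rsem_size sv; rewrite ars.
  by case: v eq_s sv => [|? [|? []]] //= [-> -> eq_u]; rewrite /rel_of eq_u.
by exists [:: z; w], [:: x; y].
Qed.

(** Unfolded from outside, membership of [[:: a; c]] passes through [[:: c; a]], [[:: b; c; a]] and
    [[:: b; b; c; a]] to [[:: a; b; b; c]], which the join splits in the middle. *)
Definition tcomp t s := TPerm (TExists (TIdent (TPerm (TJoin s t)))).

Lemma rel_comp t s a c : arity t = 2 -> arity s = 2 ->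
  rel_of (tcomp t s) a c <-> exists2 b, rel_of t a b & rel_of s b c.
Proof.
move=> art ars; rewrite /rel_of /= art ars /= -!/(rel_of _ _ _).
split=> [[b /(rsem_join2 _ _ _ _ ars art) []]|[b tab sbc]]; first by exists b.
by exists b; apply/(rsem_join2 _ _ _ _ ars art).
Qed.

(** Here [[:: a; b]] passes through [[:: a; a; b]], [[:: b; a; a]] and [[:: b; b; a; a]] to
    [[:: a; b; b; a]]; its second half is turned around, whence the [TPerm] on [s]. *)
Definition tinter t s := TIdent (TPerm (TIdent (TPerm (TJoin (TPerm s) t)))).

Lemma rel_inter t s a b : arity t = 2 -> arity s = 2 ->
  rel_of (tinter t s) a b <-> rel_of t a b /\ rel_of s a b.
Proof.
move=> art ars; have arp : arity (TPerm s) = 2 by [].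
have join := rsem_join2 a a b b arp art; rewrite /rel_of /= art ars /=.
exact: join.
Qed.

Definition tsome t := TExists (TExists t).

Lemma rsem_some t : arity t = 2 ->
  rsem I (tsome t) [::] <-> exists a b, rel_of t a b.
Proof.
move=> art; rewrite /= art /=; split=> [[b [a tab]]|[a [b tab]]].
  by exists a, b.
by exists b, a.
Qed.

Definition tincl t s := TNeg (tsome (tinter t (TNeg s))).

Lemma rsem_incl t s : arity t = 2 -> arity s = 2 ->
  rsem I (tincl t s) [::] <-> forall a b, rel_of t a b -> rel_of s a b.
Proof.
move=> art ars; have arn : arity (TNeg s) = 2 by [].
have ari : arity (tinter t (TNeg s)) = 2 by rewrite /= art ars.
split=> [[_ no] a b tab|sub].
  apply: contrapT => nsab; apply: no; apply/(rsem_some ari).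
  by exists a, b; apply/(rel_inter _ _ art arn); rewrite rel_neg.
split; first by rewrite /= art ars.
case/(rsem_some ari) => a [b /(rel_inter _ _ art arn) [/sub sab]].
by rewrite rel_neg.
Qed.

Definition ttop := TJoin (TExists TEq) (TExists TEq).

Lemma rel_top a b : rel_of ttop a b.
Proof.
by exists [:: b], [:: a]; split=> //=; [exists b; exists b|exists a; exists a].
Qed.

Definition tconj (ts : seq term) : term := foldr TJoin ttop ts.

End RelationAlgebra.

(** * Relational expressions over binary trees and the sentences stating their emptiness *)

Inductive tree := Leaf | Node (l r : tree).

Inductive rexp :=
| RLeft
| RRight
| RLeaf
| RId
| RTop
| RConv (r : rexp)
| RComp (r s : rexp)
| RInter (r s : rexp)
| RStar (r : rexp).

Fixpoint rcode (r : rexp) : nat :=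
  match r with
  | RLeft => npair 0 0
  | RRight => npair 0 1
  | RLeaf => npair 0 2
  | RId => npair 0 3
  | RTop => npair 0 4
  | RConv r => npair 1 (rcode r)
  | RComp r s => npair 2 (npair (rcode r) (rcode s))
  | RInter r s => npair 3 (npair (rcode r) (rcode s))
  | RStar r => npair 4 (rcode r)
  end.

Lemma rcode_inj : injective rcode.
Proof.
elim=> [|||||r IH|r IHr s IHs|r IHr s IHs|r IH]
  [|||||r'|r' s'|r' s'|r'] /= /npair_inj [] // _.
- by move/IH => ->.
- by case/npair_inj => /IHr -> /IHs ->.
- by case/npair_inj => /IHr -> /IHs ->.
- by move/IH => ->.
Qed.

Inductive star (A : Type) (R : A -> A -> Prop) : A -> A -> Prop :=
| star_refl a : star R a a
| star_step a b c : R a b -> star R b c -> star R a c.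

Fixpoint den (r : rexp) : tree -> tree -> Prop :=
  match r with
  | RLeft => fun a b => exists y, a = Node b y
  | RRight => fun a b => exists x, a = Node x b
  | RLeaf => fun a b => a = Leaf /\ b = Leaf
  | RId => fun a b => a = b
  | RTop => fun a b => True
  | RConv r => fun a b => den r b a
  | RComp r s => fun a c => exists2 b, den r a b & den s b c
  | RInter r s => fun a b => den r a b /\ den s a b
  | RStar r => star (den r)
  end.

(** Each expression indexes its own binary symbol. In [tm] it stands for the projections, the leaf
    test and the stars, which are constrained by axioms only. *)
Definition rsym (r : rexp) : term := TRel 2 (rcode r).

Fixpoint tm (r : rexp) : term :=
  match r with
  | RId => TEq
  | RTop => ttop
  | RConv r => TPerm (tm r)
  | RComp r s => tcomp (tm r) (tm s)
  | RInter r s => tinter (tm r) (tm s)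
  | _ => rsym r
  end.

Lemma arity_tm r : arity (tm r) = 2.
Proof. by elim: r => //= [r IHr s IHs|r IHr s IHs]; rewrite IHr IHs. Qed.

(* Closure axioms making the symbol of [RStar r] contain the reflexive
   transitive closure of [r]. *)
Fixpoint axioms (r : rexp) : seq term :=
  match r with
  | RConv r => axioms r
  | RComp r s | RInter r s => axioms r ++ axioms s
  | RStar r => [:: tincl TEq (rsym (RStar r)),
                   tincl (tcomp (tm r) (rsym (RStar r))) (rsym (RStar r))
                 & axioms r]
  | _ => [::]
  end.

(** A leaf exists, and any two elements are the projections of some element; this allows trees to be
    mapped recursively into any model. *)
Definition tree_axioms : seq term :=
  [:: tsome (tinter (rsym RLeaf) TEq);
      tincl ttop (tcomp (TPerm (rsym RLeft)) (rsym RRight))].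

Definition empty_sentence (r : rexp) : term :=
  tconj (tree_axioms ++ axioms r ++ [:: tincl (tm r) (TNeg (tm r))]).

(** Joining with a factor of arity 0 keeps or empties the rest, and the final [ttop] is nonempty
    because the domain is. *)
Lemma rsem_conj A (I : nat -> nat -> seq A -> Prop) ts :
  inhabited A -> (forall t, List.In t ts -> arity t = 0) ->
  (exists s, rsem I (tconj ts) s) <-> forall t, List.In t ts -> rsem I t [::].
Proof.
move=> [a0]; elim: ts => [|t ts IH] ar0.
  by split=> // _; exists [:: a0; a0]; apply: rel_top.
have art : arity t = 0 by apply: ar0; left.
have {}IH := IH (fun t' H => ar0 t' (or_intror H)).
split=> [[_ [u [v [_ tu tsv]]]]|all_t].
  have u0 : u = [::] by apply: size0nil; rewrite (rsem_size tu).
  move=> t' [<-|]; first by rewrite -u0.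
  by move: t'; apply: (proj1 IH); exists v.
have [s ts_s] : exists s, rsem I (tconj ts) s.
  by apply/IH => t' t'ts; apply: all_t; right.
by exists (s ++ [::]), [::], s; split=> //; apply: all_t; left.
Qed.

Lemma In_cat T (x : T) s t : List.In x (s ++ t) <-> List.In x s \/ List.In x t.
Proof. exact: List.in_app_iff. Qed.

Lemma empty_sentence_closed r t :
  List.In t (tree_axioms ++ axioms r ++ [:: tincl (tm r) (TNeg (tm r))]) ->
  arity t = 0.
Proof.
move=> /In_cat [|/In_cat []].
- by case=> [<-|[<-|]].
- elim: r => //= [r IHr s IHs|r IHr s IHs|r IH].
  1,2: by move=> /In_cat [/IHr|/IHs].
  by case=> [<-|[<-|/IH]] //=; rewrite ?arity_tm.
- by case=> // <-; rewrite /= arity_tm.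
Qed.

Section TreeModel.

(** The standard interpretation: a symbol denotes what its expression denotes over trees, so the
    stars are true closures. *)
Let I (k i : nat) (s : seq tree) : Prop :=
  exists r a b, [/\ i = rcode r, s = [:: a; b] & den r a b].

Let rel_sym r a b : rel_of I (rsym r) a b <-> den r a b.
Proof.
split=> [[_ [r' [a' [b' [/rcode_inj -> [-> ->]]]]]]|rab] //.
by split=> //; exists r, a, b.
Qed.

Let rel_tm r a b : rel_of I (tm r) a b <-> den r a b.
Proof.
elim: r a b => [|||||r IH|r IHr s IHs|r IHr s IHs|r IH] a b; try exact: rel_sym.
- exact: rel_eq.
- by split=> // _; apply: rel_top.
- by rewrite rel_perm IH.
- rewrite rel_comp ?arity_tm //.
  by split=> -[c /IHr rac /IHs scb]; exists c.
- by rewrite rel_inter ?arity_tm // IHr IHs.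
Qed.

Lemma empty_sentence_satisfiable r :
  (forall a b, ~ den r a b) -> satisfiable (empty_sentence r).
Proof.
move=> empty_r; apply/satisfiableE; exists tree; first exact: (inhabits Leaf).
exists I; apply/(rsem_conj _ (inhabits Leaf)); first exact: empty_sentence_closed.
move=> t /In_cat [|/In_cat []].
- case=> [<-|[<-|//]].
    apply/rsem_some => //; exists Leaf, Leaf; apply/rel_inter => //.
    by rewrite rel_eq rel_sym.
  apply/rsem_incl => // a b _; apply/rel_comp => //; exists (Node a b).
    by rewrite rel_perm rel_sym; exists b.
  by rewrite rel_sym; exists a.
- elim: r {empty_r} => //= [r IHr s IHs|r IHr s IHs|r IH].
  1,2: by move=> /In_cat [/IHr|/IHs].
  case=> [<-|[<-|/IH //]].
    apply/rsem_incl => // a b; rewrite rel_eq rel_sym => ->.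
    exact: star_refl.
  have ar2 : arity (tcomp (tm r) (rsym (RStar r))) = 2 by rewrite /= arity_tm.
  apply/rsem_incl => // a c; rewrite rel_comp ?arity_tm //.
  case=> b; rewrite rel_tm !rel_sym; exact: star_step.
- case=> // <-; apply/rsem_incl; rewrite /= ?arity_tm // => a b /rel_tm rab.
  by case: (empty_r a b).
Qed.

End TreeModel.

Section ArbitraryModel.
Variables (A : Type) (I : nat -> nat -> seq A -> Prop).

(** All operations are positive, so a map respecting leaf and projections preserves them; a star
    path is followed with the closure axioms. *)
Lemma den_hom (c : tree -> A) r :
  rel_of I (rsym RLeaf) (c Leaf) (c Leaf) ->
  (forall x y, rel_of I (rsym RLeft) (c (Node x y)) (c x)) ->
  (forall x y, rel_of I (rsym RRight) (c (Node x y)) (c y)) ->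
  (forall t, List.In t (axioms r) -> rsem I t [::]) ->
  forall x y, den r x y -> rel_of I (tm r) (c x) (c y).
Proof.
move=> cleaf cleft cright.
elim: r => [|||||r IH|r IHr s IHs|r IHr s IHs|r IH] /= ax x y.
- by case=> z ->; apply: cleft.
- by case=> z ->; apply: cright.
- by case=> -> ->.
- by move=> ->; apply/rel_eq.
- by move=> _; apply: rel_top.
- by move/(IH ax); rewrite rel_perm.
- have {}IHr := IHr (fun t H => ax t (proj2 (In_cat _ _ _) (or_introl H))).
  have {}IHs := IHs (fun t H => ax t (proj2 (In_cat _ _ _) (or_intror H))).
  by case=> z /IHr rxz /IHs szy; apply/rel_comp; rewrite ?arity_tm //; exists (c z).
- have {}IHr := IHr (fun t H => ax t (proj2 (In_cat _ _ _) (or_introl H))).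
  have {}IHs := IHs (fun t H => ax t (proj2 (In_cat _ _ _) (or_intror H))).
  by case=> /IHr rxy /IHs sxy; apply/rel_inter; rewrite ?arity_tm.
- have {}IH := IH (fun t H => ax t (or_intror (or_intror H))).
  have arc : arity (tcomp (tm r) (rsym (RStar r))) = 2 by rewrite /= arity_tm.
  have /rsem_incl refl := ax _ (or_introl erefl).
  have /(rsem_incl _ arc) trans := ax _ (or_intror (or_introl erefl)).
  elim=> [a|a b d /IH rab _ sbd]; first by apply: refl => //; apply/rel_eq.
  by apply: trans => //; apply/rel_comp; rewrite ?arity_tm //; exists (c b).
Qed.

Lemma empty_sentence_sound r (a0 : A) :
  (forall t, List.In t (tree_axioms ++ axioms r ++ [:: tincl (tm r) (TNeg (tm r))]) ->
     rsem I t [::]) ->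
  forall x y, ~ den r x y.
Proof.
move=> sat.
have axP t : List.In t (axioms r) -> rsem I t [::].
  by move=> H; apply/sat/In_cat/or_intror/In_cat/or_introl.
have /rsem_some [//|l [l' /rel_inter [] // Lll' /rel_eq eq_l]] :=
  sat _ (or_introl erefl).
have /rsem_incl pairs := sat _ (or_intror (or_introl erefl)).
have {}pairs (p : A * A) :
    exists z, rel_of I (rsym RLeft) z p.1 /\ rel_of I (rsym RRight) z p.2.
  have /rel_comp [//|//|z] := pairs erefl erefl p.1 p.2 (rel_top _ _ _).
  by rewrite rel_perm; exists z.
(* Choice makes pairing a function [f] on the model; recursion on trees then gives the homomorphism
   [c]. *)
have [f fP] := choice pairs.
pose c := fix c x := if x is Node y z then f (c y, c z) else l.
have hom : forall x y, den r x y -> rel_of I (tm r) (c x) (c y).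
  apply: den_hom => // [|x y|x y]; first by rewrite -{}eq_l in Lll'.
    by case: (fP (c x, c y)).
  by case: (fP (c x, c y)).
have /rsem_incl empty_r : rsem I (tincl (tm r) (TNeg (tm r))) [::].
  by apply: sat; apply/In_cat; right; apply/In_cat; right; left.
move=> x y /hom rxy; have := empty_r (arity_tm r) (arity_tm r) _ _ rxy.
by rewrite rel_neg ?arity_tm.
Qed.

End ArbitraryModel.

Lemma empty_sentenceP r :
  satisfiable (empty_sentence r) <-> forall x y, ~ den r x y.
Proof.
split=> [/satisfiableE [A [a0] [I /rsem_conj sat]]|].
  exact/(empty_sentence_sound a0)/sat/empty_sentence_closed.
exact: empty_sentence_satisfiable.
Qed.

(** * Recursive functions as relations on trees *)

Section Programs.

Definition rpair r s := RInter (RComp r (RConv RLeft)) (RComp s (RConv RRight)).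
Definition rleaf := RComp RTop RLeaf.
(** The factor ending in [RTop] relates an input to everything exactly when [r] can yield a leaf
    there, so the intersection restricts [s] to such inputs. In [rcase_node] the same is done with
    [RRight], which is defined only on nodes. *)
Definition rcase_leaf r s := RInter s (RComp (RComp r RLeaf) RTop).
Definition rcase_node r s := RInter s (RComp (RComp r RRight) RTop).

Lemma den_comp r s a c :
  den (RComp r s) a c <-> exists2 b, den r a b & den s b c.
Proof. by []. Qed.

Lemma den_pair r s a b :
  den (rpair r s) a b <-> exists x y, [/\ b = Node x y, den r a x & den s a y].
Proof.
split=> [[[x rax [y ->]] [z saz [t [_ ez]]]]|[x [y [-> rax say]]]] /=.
  by exists x, y; split=> //; rewrite ez.
by split; [exists x => //; exists y|exists y => //; exists x].
Qed.

(** At the argument a, the relation is single-valued with value b, like a deterministic program. *)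
Definition computes r a b := forall z, den r a z <-> z = b.

Lemma computes_id a : computes RId a a.
Proof. by move=> z; split. Qed.

Lemma computes_left x y : computes RLeft (Node x y) x.
Proof. by move=> z; split=> [[t []]|->] //; exists y. Qed.

Lemma computes_right x y : computes RRight (Node x y) y.
Proof. by move=> z; split=> [[t []]|->] //; exists x. Qed.

Lemma computes_leaf a : computes rleaf a Leaf.
Proof. by move=> z; split=> [[b _ []]|->] //; exists Leaf. Qed.

Lemma computes_comp r s a b c :
  computes r a b -> computes s b c -> computes (RComp r s) a c.
Proof.
by move=> rab sbc z; split=> [[y /rab -> /sbc]|/sbc sbz] //; exists b; first exact/rab.
Qed.

Lemma computes_pair r s a b c :
  computes r a b -> computes s a c -> computes (rpair r s) a (Node b c).
Proof.
move=> rab sac z; rewrite den_pair; split=> [[x [y [-> /rab -> /sac ->]]]|->] //.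
by exists b, c; split; [|exact/rab|exact/sac].
Qed.

Lemma den_case_leaf r s a b z : computes r a b ->
  den (rcase_leaf r s) a z <-> b = Leaf /\ den s a z.
Proof.
move=> rab; split=> [[saz [x [y /rab -> [-> _]] _]]|[eb saz]] //.
by split=> //; exists Leaf => //; exists b; [exact/rab|].
Qed.

Lemma den_case_node r s a b z : computes r a b ->
  den (rcase_node r s) a z <-> b <> Leaf /\ den s a z.
Proof.
move=> rab; split=> [[saz [x [y /rab -> [t ->]] _]]|[b_node saz]] //.
case: b rab b_node => // x y rab _; split=> //.
by exists y => //; exists (Node x y); [exact/rab|exists x].
Qed.

(** Unary numerals: the leaf test is the zero test, and [RRight] is the predecessor on positive
    numerals. *)
Fixpoint num (n : nat) : tree := if n is m.+1 then Node Leaf (num m) else Leaf.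

Definition enc (s : seq nat) : tree := foldr (fun n => Node (num n)) Leaf s.

Definition rsucc r := rpair rleaf r.

Lemma computes_succ r a n :
  computes r a (num n) -> computes (rsucc r) a (num n.+1).
Proof. by move=> rn; apply: computes_pair => //; apply: computes_leaf. Qed.

Fixpoint rnth i := if i is j.+1 then RComp RRight (rnth j) else RLeft.

Lemma computes_nth s i : i < size s -> computes (rnth i) (enc s) (num (nth 0 s i)).
Proof.
elim: s i => // n s IH [|i] lti /=; first exact: computes_left.
apply: computes_comp (computes_right _ _) (IH i lti).
Qed.

Definition computable k (f : k.-tuple nat -> nat) : Prop :=
  exists r, forall v : k.-tuple nat, computes r (enc v) (num (f v)).

Lemma computable_comp k m (f : m.-tuple nat -> nat) (g : 'I_m -> k.-tuple nat -> nat) :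
  computable f -> (forall i, computable (g i)) ->
  computable (fun v => f [tuple g i v | i < m]).
Proof.
move=> [rf rfP] /choice [rg rgP].
exists (RComp (foldr rpair rleaf [seq rg i | i <- enum 'I_m]) rf) => v.
apply: computes_comp (rfP _).
rewrite -[X in computes _ _ (enc X)]map_tnth_enum.
rewrite (eq_map (tnth_mktuple (fun i => g i v))).
elim: (enum _) => [|i s IH] /=.
  exact: computes_leaf.
exact: computes_pair (rgP i v) IH.
Qed.

Lemma star_inv (A : Type) (R : A -> A -> Prop) a c :
  star R a c -> a = c \/ exists2 b, R a b & star R b c.
Proof. by case=> [b|b d e Rbd Rde]; [left|right; exists d]. Qed.

Definition rwhile test body out :=
  RComp (RStar (rcase_node test body)) (rcase_leaf test out).

Lemma den_while test body out a z :
  den (rwhile test body out) a z <->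
  exists2 b, star (den (rcase_node test body)) a b & den (rcase_leaf test out) b z.
Proof. by []. Qed.

(** States are indexed by the number of steps left. The two guards exclude each other, so the run
    from [s N] is forced and can exit only at [s 0]. *)
Lemma computes_while test body out (s t : nat -> tree) N b :
  (forall r, r <= N -> computes test (s r) (t r)) ->
  t 0 = Leaf -> (forall r, r < N -> t r.+1 <> Leaf) ->
  (forall r, r < N -> computes body (s r.+1) (s r)) ->
  computes out (s 0) b -> computes (rwhile test body out) (s N) b.
Proof.
move=> testP t0 tS bodyP outP z.
have stop : den (rcase_leaf test out) (s 0) z <-> z = b.
  by rewrite (den_case_leaf _ _ (testP 0 (leq0n N))) t0 -outP; split=> [[]|].
rewrite den_while; elim: N testP tS bodyP => [|N IH] testP tS bodyP.
  split=> [[c stepc finc]|/stop].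
    case: (star_inv stepc) finc => [<- /stop //|[d]].
    by rewrite (den_case_node _ _ (testP 0 isT)) t0 => -[].
  by exists (s 0); first exact: star_refl.
have test_ne : t N.+1 <> Leaf by apply: tS.
have {}IH := IH (fun r H => testP r (leqW H)) (fun r H => tS r (leqW H))
  (fun r H => bodyP r (leqW H)).
split=> [[c stepc finc]|ez].
  case: (star_inv stepc) finc => [<-|[d]].
    by rewrite (den_case_leaf _ _ (testP _ (leqnn _))) => -[].
  rewrite (den_case_node _ _ (testP _ (leqnn _))) => -[_ /(bodyP N (ltnSn N)) ->].
  by move=> stepd finc; apply/IH; exists c.
have /IH [c stepc finc] := ez; exists c => //; apply: star_step stepc.
apply/(den_case_node _ _ (testP _ (leqnn _))); split=> //.
exact/(bodyP N (ltnSn N)).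
Qed.

Lemma computable_prim k (f : k.-tuple nat -> nat) (g : k.+2.-tuple nat -> nat)
    (h : k.+1.-tuple nat -> nat) :
  computable f -> computable g ->
  (forall v : k.-tuple nat, h [tuple of 0 :: v] = f v) ->
  (forall n (v : k.-tuple nat),
     h [tuple of n.+1 :: v] = g [tuple of n :: h [tuple of n :: v] :: v]) ->
  computable h.
Proof.
move=> [rf rfP] [rg rgP] h0 hS.
pose rest := RComp RRight RLeft.
pose acc := RComp RRight (RComp RRight RLeft).
pose args := RComp RRight (RComp RRight RRight).
pose init := rpair rleaf (rpair RLeft (rpair (RComp RRight rf) RRight)).
pose body := rpair (rsucc RLeft) (rpair (RComp rest RRight)
  (rpair (RComp (rpair RLeft (rpair acc args)) rg) args)).
exists (RComp init (rwhile rest body acc)) => w.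
case/tupleP: w => n v.
(* A state holds the counter, the number of steps left, the value at the counter, and the
   parameters. *)
pose st i r := Node (num i) (Node (num r) (Node (num (h [tuple of i :: v])) (enc v))).
have restP i r : computes rest (st i r) (num r).
  exact: computes_comp (computes_right _ _) (computes_left _ _).
have accP i r : computes acc (st i r) (num (h [tuple of i :: v])).
  apply: computes_comp (computes_right _ _) _.
  exact: computes_comp (computes_right _ _) (computes_left _ _).
have argsP i r : computes args (st i r) (enc v).
  apply: computes_comp (computes_right _ _) _.
  exact: computes_comp (computes_right _ _) (computes_right _ _).
apply: (@computes_comp _ _ _ (st 0 n)).
  apply: computes_pair; first exact: computes_leaf.
  apply: computes_pair; first exact: computes_left.
  apply: computes_pair; last exact: computes_right.
  by rewrite h0; apply: computes_comp (computes_right _ _) (rfP v).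
(* The initial counter 0 is written n - n, to fit states whose counter is n - r when r steps are
   left. *)
rewrite -(subnn n).
apply: (@computes_while _ _ _ (fun r => st (n - r) r) num) => //.
  move=> r ltr; rewrite -(subnSK ltr).
  apply: computes_pair; first exact/computes_succ/computes_left.
  apply: computes_pair.
    exact: computes_comp (restP _ r.+1) (computes_right Leaf (num r)).
  apply: computes_pair; last exact: argsP.
  rewrite hS; apply: computes_comp _ (rgP _).
  apply: computes_pair (computes_left _ _) _.
  exact: computes_pair (accP _ _) (argsP _ _).
by rewrite subn0; apply: accP.
Qed.

(** Search upward from 0 with [f] as the loop test. With r steps left the candidate is [h v - r],
    where [f] is nonzero for positive r by minimality. *)
Lemma computable_min k (f : k.+1.-tuple nat -> nat) (h : k.-tuple nat -> nat) :
  computable f ->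
  (forall v : k.-tuple nat, f [tuple of h v :: v] = 0) ->
  (forall (v : k.-tuple nat) n, n < h v -> f [tuple of n :: v] <> 0) ->
  computable h.
Proof.
move=> [rf rfP] h0 hS.
exists (RComp (rpair rleaf RId) (rwhile rf (rpair (rsucc RLeft) RRight) RLeft)) => v.
apply: (@computes_comp _ _ _ (enc (0 :: v))).
  exact: computes_pair (computes_leaf _) (computes_id _).
rewrite -(subnn (h v)).
pose t r := num (f [tuple of h v - r :: v]).
apply: (@computes_while _ _ _ (fun r => enc (h v - r :: v)) t) => [r _||r ltr|r ltr|].
- exact: (rfP [tuple of h v - r :: v]).
- by rewrite /t subn0 h0.
- rewrite /t; case E: (f _) => [|//]; case: (hS v (h v - r.+1)) => //.
  by rewrite ltn_subrL (leq_trans _ ltr).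
- rewrite -(subnSK ltr).
  exact: computes_pair (computes_succ (computes_left _ _)) (computes_right _ _).
- by rewrite subn0; apply: computes_left.
Qed.

Lemma recursive_computable k (f : k.-tuple nat -> nat) :
  recursive f -> computable f.
Proof.
elim=> {k f} [k||k i|k m f g _ IHf _ IHg|k f g h _ IHf _ IHg h0 hS|k f h _ IHf h0 hS].
- by exists rleaf => v; apply: computes_leaf.
- exists (rsucc RLeft) => v; rewrite [v]tuple_eta [tnth _ _]/= .
  exact: computes_succ (computes_left _ _).
- exists (rnth i) => v; rewrite (tnth_nth 0); apply: computes_nth.
  by rewrite size_tuple.
- exact: computable_comp.
- exact: computable_prim IHf IHg h0 hS.
- exact: computable_min IHf h0 hS.
Qed.

End Programs.

(** * The reduction *)

(** Operations on terms tracked by recursive functions on codes, so that the reduction is seen to be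
    recursive from the shape of its terms. *)
Definition code_operator (f : term -> term) : Prop :=
  exists2 F : nat -> nat, recursive (fun v : 1.-tuple nat => F (tnth v ord0)) &
    forall t, code (f t) = F (code t).

Section CodeOperators.

Lemma code_operator_id : code_operator id.
Proof. by exists id => //; apply: rec_proj. Qed.

Lemma code_operator_const t : code_operator (fun=> t).
Proof. by exists (fun=> code t) => //; apply: rec_const. Qed.

Lemma code_operator_unary n (c f : term -> term) :
  (forall t, code (c t) = npair n (code t)) -> code_operator f ->
  code_operator (c \o f).
Proof.
move=> codec [F RF codef]; exists (fun x => npair n (F x)).
  by apply: rec_npair => //; apply: rec_const.
by move=> t; rewrite /= codec codef.
Qed.

Lemma code_operator_perm f :
  code_operator f -> code_operator (fun t => TPerm (f t)).
Proof. exact: (@code_operator_unary 2). Qed.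

Lemma code_operator_ident f :
  code_operator f -> code_operator (fun t => TIdent (f t)).
Proof. exact: (@code_operator_unary 3). Qed.

Lemma code_operator_neg f :
  code_operator f -> code_operator (fun t => TNeg (f t)).
Proof. exact: (@code_operator_unary 4). Qed.

Lemma code_operator_exists f :
  code_operator f -> code_operator (fun t => TExists (f t)).
Proof. exact: (@code_operator_unary 6). Qed.

Lemma code_operator_join f g : code_operator f -> code_operator g ->
  code_operator (fun t => TJoin (f t) (g t)).
Proof.
move=> [F RF codef] [G RG codeg]; exists (fun x => npair 5 (npair (F x) (G x))).
  by apply: rec_npair; [apply: rec_const|apply: rec_npair].
by move=> t; rewrite /= codef codeg.
Qed.

Lemma code_operator_comp f g : code_operator f -> code_operator g ->
  code_operator (fun t => tcomp (f t) (g t)).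
Proof.
move=> Of Og; apply/code_operator_perm/code_operator_exists.
exact/code_operator_ident/code_operator_perm/code_operator_join.
Qed.

Lemma code_operator_inter f g : code_operator f -> code_operator g ->
  code_operator (fun t => tinter (f t) (g t)).
Proof.
move=> Of Og; apply/code_operator_ident/code_operator_perm/code_operator_ident.
exact/code_operator_perm/code_operator_join/Of/code_operator_perm.
Qed.

Lemma code_operator_incl f g : code_operator f -> code_operator g ->
  code_operator (fun t => tincl (f t) (g t)).
Proof.
move=> Of Og; apply/code_operator_neg/code_operator_exists/code_operator_exists.
exact/code_operator_inter/code_operator_neg.
Qed.

Lemma code_operator_conj ts f : code_operator f ->
  code_operator (fun t => tconj (ts ++ [:: f t])).
Proof.
move=> Of; elim: ts => [|t ts IH] /=.
  by apply: code_operator_join => //; apply: code_operator_const.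
by apply: code_operator_join => //; apply: code_operator_const.
Qed.

(** The codes of the iterates of [g] arise by primitive recursion from the code of [u 0]; this
    handles terms with a numeral wired in. *)
Lemma rec_code_operator f g (u : nat -> term) :
  code_operator f -> code_operator g -> (forall n, u n.+1 = g (u n)) ->
  recursive (fun v : 1.-tuple nat => code (f (u (tnth v ord0)))).
Proof.
move=> [F RF codef] [G RG codeg] uS.
have Ru : recursive (fun v : 1.-tuple nat => code (u (tnth v ord0))).
  pose s (i acc : nat) (v : 1.-tuple nat) := G acc.
  apply: rec_ext (@rec_nat_rect 1 _ _ s (rec_head 0) (rec_const 1 (code (u 0))) _).
    move=> v; rewrite -[thead v]/(tnth v ord0).
    by elim: (tnth v ord0) => //= n IH; rewrite /s IH uS codeg.
  by apply: rec_ext (rec_app1 RG (rec_lift (rec_head 1))) => w.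
by apply: rec_ext (rec_app1 RF Ru) => v; rewrite codef.
Qed.

End CodeOperators.

Section Reduction.
Variables (R : 2.-tuple nat -> bool) (r : rexp).
Hypothesis rP : forall v : 2.-tuple nat, computes r (enc v) (num (R v)).

Fixpoint rnum n := if n is m.+1 then rpair rleaf (rnum m) else rleaf.

Lemma computes_num n a : computes (rnum n) a (num n).
Proof.
elim: n => [|n IH]; first exact: computes_leaf.
exact: computes_pair (computes_leaf _) IH.
Qed.

(** Numerals contain no star, so the axioms in the reduction do not vary with its input. *)
Lemma axioms_num n : axioms (rnum n) = [::].
Proof. by elim: n => //= n ->. Qed.

(** A nondeterministic guess of a number. *)
Definition rnat := RComp rleaf (RStar (rsucc RId)).

Lemma den_nat a b : den rnat a b <-> exists n, b = num n.
Proof.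
have succP c d : den (rsucc RId) c d <-> d = Node Leaf c.
  exact: (computes_pair (computes_leaf c) (computes_id c)).
have starP m n : star (den (rsucc RId)) (num m) (num (n + m)).
  elim: n m => [|n IH] m; first exact: star_refl.
  by apply: (@star_step _ _ _ (num m.+1)); [apply/succP|rewrite addSnnS].
have starI c d : star (den (rsucc RId)) c d ->
    (exists m, c = num m) -> exists n, d = num n.
  elim=> // {}c {}d e /succP -> _ IH [m ec].
  by apply: IH; exists m.+1; rewrite ec.
rewrite den_comp; split=> [[c /computes_leaf -> /starI H]|[n ->]].
  by apply: H; exists 0.
by exists Leaf; [apply/computes_leaf|have := starP 0 n; rewrite addn0].
Qed.

(** With [n] wired in, guess y, run [r] on the pair and accept only the answer [Leaf], the numeral
    of [false]. *)
Definition rfails n := RComp (rpair (rnum n) (rpair rnat rleaf)) (RComp r RLeaf).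

Lemma den_fails x :
  (forall a b, ~ den (rfails x) a b) <-> forall y, R [tuple x; y].
Proof.
split=> [no_den y|allR a b].
  apply: contraT => /negbTE nR; case: (no_den Leaf Leaf).
  exists (enc [:: x; y]).
    apply/den_pair; exists (num x), (enc [:: y]); split=> //.
      exact/computes_num.
    apply/den_pair; exists (num y), Leaf; split=> //; last exact/computes_leaf.
    by apply/den_nat; exists y.
  by exists Leaf => //; apply/(rP [tuple x; y]); rewrite nR.
rewrite den_comp => -[c /den_pair [x' [v [-> /computes_num ->]]]].
move=> /den_pair [y' [v' [-> /den_nat [y ->] /computes_leaf ->]]].
by rewrite den_comp => -[d /(rP [tuple x; y]) -> []]; rewrite allR.
Qed.

Lemma rec_code_fails :
  recursive (fun v : 1.-tuple nat => code (empty_sentence (rfails (tnth v ord0)))).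
Proof.
pose inj side t := tcomp t (TPerm (rsym side)).
(* [f] is the context of the numeral in [tm (rfails r n)], and [g] leads from the term of one
   numeral to that of the next. *)
pose f t := tcomp (tinter (inj RLeft t) (inj RRight (tm (rpair rnat rleaf))))
                  (tm (RComp r RLeaf)).
pose g t := tinter (inj RLeft (tm rleaf)) (inj RRight t).
pose F t := tconj ((tree_axioms ++ axioms (rfails 0)) ++ [:: tincl (f t) (TNeg (f t))]).
have Oinj side h : code_operator h -> code_operator (fun t => inj side (h t)).
  by move=> Oh; apply: code_operator_comp => //; apply: code_operator_const.
have OF : code_operator F.
  have Of : code_operator f.
    apply: code_operator_comp; last exact: code_operator_const.
    apply: code_operator_inter; last exact: code_operator_const.
    exact/Oinj/code_operator_id.
  exact/code_operator_conj/code_operator_incl/code_operator_neg.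
have Og : code_operator g.
  apply: code_operator_inter; first exact: code_operator_const.
  exact/Oinj/code_operator_id.
apply: rec_ext (@rec_code_operator F g (fun n => tm (rnum n)) OF Og _) => // v.
rewrite /F -catA /empty_sentence; congr (code (tconj (_ ++ _ ++ _))).
by rewrite /= !axioms_num.
Qed.

End Reduction.

Theorem corollary6p5 : Pi01_complete GRA_SAT.
Proof.
split; first exact: GRA_SAT_Pi01.
move=> B [R [/recursive_computable [r rP] BE]].
exists (fun v => code (empty_sentence (rfails r (tnth v ord0)))).
split=> [|x]; first exact: rec_code_fails.
(* Membership in B means that no y makes [R] fail, so the failure relation is empty, which is the
   satisfiability of its emptiness sentence. *)
rewrite BE -(den_fails rP) -empty_sentenceP.
by split=> [sat|[t sat /code_inj <-]] //; exists (empty_sentence (rfails r x)).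
Qed.
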